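(* Let $(X,D)$ be a locally compact, complete metric space and let $\alpha>1$. Let $\Omega\subseteq X$ be an open set such that $\mathcal D_\alpha(\Omega)\neq\varnothing$. Let $(d_n)_{n\in\mathbb N}\subseteq\mathcal D_\alpha(\Omega)$ and $d\in\mathcal D_\alpha(\Omega)$. Then the following conditions are equivalent: (i) $d_n\to d$ in $\mathcal D_\alpha(\Omega)$, i.e. uniformly on compact subsets of $\Omega\times\Omega$. (ii) $J_{d_n}\xrightarrow{\Gamma}J_d$ in $\mathcal B(\Omega)$. (iii) $L_{\bar d_n}\xrightarrow{\Gamma}L_{\bar d}$ in $\mathrm{Lip}([0,1];\bar\Omega)$. (iv) $F_{d_n}\xrightarrow{\Gamma}F_d$ in $\mathrm{Lip}(\Omega)$.
   Context: Length: for a metric space $(E,\rho)$ and a continuous curve $\gamma\colon[a,b]\to E$, $L_\rho(\gamma):=\sup\{\sum_{i=1}^k\rho(\gamma_{t_i},\gamma_{t_{i-1}}) : k\in\mathbb N,\ a=t_0<t_1<\dots<t_k=b\}\in[0,+\infty]$. $(E,\rho)$ is a length space if $\rho(x,y)=\inf\{L_\rho(\gamma) : \gamma\colon[0,1]\to E \text{ Lipschitz},\ \gamma_0=x,\ \gamma_1=y\}$ for all $x,y\in E$. The class $\mathcal D_\alpha(\Omega)$: the set of all distances $d$ on $\Omega$ such that $(\Omega,d)$ is a length space and $\alpha^{-1}D(x,y)\le d(x,y)\le\alpha D(x,y)$ for all $x,y\in\Omega$. It is endowed with the topology of uniform convergence on compact subsets of $\Omega\times\Omega$. (The topology on $\Omega$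 and $\bar\Omega$ is that induced by $D$; $\bar\Omega$ is the closure of $\Omega$ in $X$.) Extension to the closure: for $d\in\mathcal D_\alpha(\Omega)$, $\bar d\colon\bar\Omega\times\bar\Omega\to[0,+\infty)$ denotes the unique continuous extension of $d$; it is a distance on $\bar\Omega$ with $\alpha^{-1}D\le\bar d\le\alpha D$. Function spaces: $\mathrm{Lip}([0,1];\bar\Omega)$ is the set of Lipschitz curves from $[0,1]$ to $(\bar\Omega,D)$, with the topology of uniform convergence; $\mathrm{Lip}(\Omega)$ is the set of Lipschitz functions $u\colon(\Omega,D)\to\mathbb R$, with the topology of uniform convergence on compact subsets of $\Omega$. (Since $d$ is comparable to $D$, Lipschitz with respect to $D$ or $d$ is the same.) $\mathrm{Lip}_d(u)$ denotes the Lipschitz constant of $u$ with respect to $d$. $\mathcal B(\Omega)$ is the set of all finite non-negative Borel measures $\mu$ on $\Omega\times\Omega$, with the topology induced by the weak$^*$ topology of the space of finite signed Borel measures on $\Omega\times\Omega$, viewed as the dual of $C_0(\Omega\times\Omega)$ (the closure of $C_c(\Omega\times\Omega)$ in the sup norm). Functionals, for $d\in\mathcal D_\alpha(\Omega)$: $J_d\colon\mathcal B(\Omega)\to[0,+\infty]$, $J_d(\mu):=\int d(x,y)\,\mathrm d\mu(x,y)$. $F_d\colon\mathrm{Lip}(\Omega)\to[0,+\infty]$, $F_d(u):=0$ if $\mathrm{Lip}_d(u)\le1$ and $F_d(u):=+\infty$ otherwise. $L_{\bar d}$ is the length functional of $(\bar\Omega,\bar d)$ restricted to $\mathrm{Lip}([0,1];\bar\Omega)$.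 $\Gamma$-convergence: functionals $G_n\colon T\to[0,+\infty]$ on a topological space $T$ $\Gamma$-converge to $G\colon T\to[0,+\infty]$, written $G_n\xrightarrow{\Gamma}G$, if for every $x\in T$: ($\Gamma$-liminf) $G(x)\le\liminf_n G_n(x_n)$ for every sequence $x_n\to x$ in $T$; and ($\Gamma$-limsup) there is a sequence $x_n\to x$ in $T$ with $\limsup_n G_n(x_n)\le G(x)$. *)

(* Defs.v *)
From HB Require Import structures.
From mathcomp Require Import all_boot all_order all_algebra.
From mathcomp Require Import all_classical all_reals all_analysis.

Import Order.TTheory GRing.Theory Num.Theory.
Import numFieldNormedType.Exports.

Local Open Scope classical_set_scope.
Local Open Scope ring_scope.

(* The library's [completeType] is pointed, hence nonempty; this does not ask
   for a point. *)
Definition complete_space (T : uniformType) : Prop :=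
  forall F : set_system T, ProperFilter F -> cauchy F -> exists x : T, F --> x.

Section Distances.
Context {R : realType}.

Definition is_distance {E : Type} (rho : E * E -> R) : Prop :=
  [/\ forall x y, 0 <= rho (x, y),
      forall x y, rho (x, y) = 0 <-> x = y,
      forall x y, rho (x, y) = rho (y, x) &
      forall x y z, rho (x, z) <= rho (x, y) + rho (y, z)].

Definition is_Lipschitz {E F : Type} (rho : E * E -> R) (sigma : F * F -> R)
    (f : E -> F) : Prop :=
  exists K : R, forall x y, sigma (f x, f y) <= K * rho (x, y).

Definition eucl_dist (z : R * R) : R := `|z.1 - z.2|.

Definition restrict_dist {T : Type} {A : set T} (rho : T * T -> R)
    (z : A * A) : R := rho (\val z.1, \val z.2).

Definition partition_points {a b : R} (k : nat) (t : nat -> `[a, b]%classic)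
    : Prop :=
  [/\ \val (t 0%N) = a, \val (t k) = b &
      forall i, (i < k)%N -> \val (t i) < \val (t i.+1)].

Definition curve_length {E : Type} (rho : E * E -> R) {a b : R}
    (gamma : `[a, b]%classic -> E) : \bar R :=
  ereal_sup [set l | exists (k : nat) (t : nat -> `[a, b]%classic),
    partition_points k t /\
    l = (\sum_(1 <= i < k.+1) rho (gamma (t i), gamma (t i.-1)))%:E].

Definition Lipschitz_curve {E : Type} (rho : E * E -> R)
    (gamma : `[0 : R, 1]%classic -> E) : Prop :=
  is_Lipschitz (restrict_dist eucl_dist) rho gamma.

Definition joins {E : Type} (gamma : `[0 : R, 1]%classic -> E) (x y : E)
    : Prop :=
  (forall t, \val t = 0 -> gamma t = x) /\ (forall t, \val t = 1 -> gamma t = y).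

Definition is_length_space {E : Type} (rho : E * E -> R) : Prop :=
  forall x y : E,
    (rho (x, y))%:E =
    ereal_inf [set curve_length rho gamma | gamma in
                [set gamma | Lipschitz_curve rho gamma /\ joins gamma x y]].

(* The supremum of difference quotients; the maximum with 0 only matters when
   E has at most one point. *)
Definition Lip_const {E : Type} (rho : E * E -> R) (u : E -> R) : \bar R :=
  maxe 0%E (ereal_sup [set q | exists x y : E,
    x <> y /\ q = (`|u x - u y| / rho (x, y))%:E]).

End Distances.

Section Gamma_convergence.
Context {R : realType} {T : topologicalType}.
Local Open Scope ereal_scope.

Definition Gamma_cvg (G_ : nat -> T -> \bar R) (G : T -> \bar R) : Prop :=
  forall x : T,
    (forall x_ : nat -> T, x_ n @[n --> \oo] --> x ->
       G x <= limn_einf (fun n => G_ n (x_ n))) /\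
    (exists2 x_ : nat -> T, x_ n @[n --> \oo] --> x &
       limn_esup (fun n => G_ n (x_ n)) <= G x).

End Gamma_convergence.

(* Measurable spaces of the library are pointed. [at_point T t0] is T with the
   point t0; neither the topology nor the Borel sets depend on t0. *)
Definition at_point {T : Type} (t0 : T) : Type := T.

Section Borel_measures.
Context {T : topologicalType} (t0 : T).

HB.instance Definition _ := Topological.copy (at_point t0) T.
HB.instance Definition _ := isPointed.Build (at_point t0) t0.

Definition borel_space := g_sigma_algebraType (@open (at_point t0)).
HB.instance Definition _ := Measurable.on borel_space.

End Borel_measures.

Definition Cc (R : realType) (T : topologicalType) : set {uniform T -> R} :=
  [set f : {uniform T -> R} | continuous (f : T -> R) /\
                              compact (closure [set x : T | f x != 0])].

Definition C0 (R : realType) (T : topologicalType) : set {uniform T -> R} :=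
  closure (Cc R T).

Definition borel_measures (R : realType) {T : topologicalType} (t0 : T) : Type :=
  {finite_measure set (borel_space t0) -> \bar R}.

Section Weak_star.
Context {R : realType} {T : topologicalType} (t0 : T).

HB.instance Definition _ := gen_eqMixin (borel_measures R t0).
HB.instance Definition _ := gen_choiceMixin (borel_measures R t0).

(* The family of evaluations at the elements of C0; the topology it induces is
   the trace on the finite measures of the weak-star topology. *)
Definition duality (mu : borel_measures R t0) : {ptws C0 R T -> R} :=
  fun f => \int[mu]_(x in setT) (\val f x).

HB.instance Definition _ :=
  Topological.copy (borel_measures R t0) (initial_topology duality).

End Weak_star.

Section Spaces_and_functionals.
Context {R : realType} {X : metricType R}.
Implicit Types (alpha : R) (Omega : set X).

Definition ambient_dist {A : set X} : A * A -> R :=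
  restrict_dist (fun z : X * X => mdist z.1 z.2).

Definition length_distances alpha Omega
    : set {family compact, (Omega * Omega)%type -> R} :=
  [set d | [/\ is_distance d, is_length_space d &
    forall z, alpha^-1 * ambient_dist z <= d z <= alpha * ambient_dist z]].

Definition to_closure {Omega} (x : Omega) : closure Omega :=
  SigSub (mem_set (subset_closure (set_valP x))).

(* The unique continuous extension: it exists for every d with
   alpha^-1 D <= d <= alpha D that is a distance, and is unique by density, so
   that the default value 0 of [xget] is then never used. *)
Definition closure_extension {Omega} (d : Omega * Omega -> R)
    : closure Omega * closure Omega -> R :=
  xget (fun=> 0) [set f | continuous f /\
    forall x y : Omega, f (to_closure x, to_closure y) = d (x, y)].

Definition Lip_curves Omega : set {uniform `[0 : R, 1]%classic -> closure Omega} :=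
  [set gamma | Lipschitz_curve ambient_dist gamma].

Definition Lip_functions Omega : set {family compact, Omega -> R} :=
  [set u | is_Lipschitz ambient_dist eucl_dist u].

Definition J_ {alpha Omega} (z0 : Omega * Omega) (d : length_distances alpha Omega)
    (mu : borel_measures R z0) : \bar R :=
  (\int[mu]_(z in setT) (\val d z)%:E)%E.

Definition L_ {alpha Omega} (d : length_distances alpha Omega)
    (gamma : Lip_curves Omega) : \bar R :=
  curve_length (closure_extension (\val d)) (\val gamma).

Definition F_ {alpha Omega} (d : length_distances alpha Omega)
    (u : Lip_functions Omega) : \bar R :=
  if (Lip_const (\val d) (\val u) <= 1)%E then 0%E else +oo%E.

End Spaces_and_functionals.

(* Main.v *)
From HB Require Import structures.
Require Import Defs.
From mathcomp Require Import all_boot all_order all_algebra.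
From mathcomp Require Import all_classical all_reals all_analysis.
From mathcomp Require Import measurable_realfun ring lra.

Import Order.TTheory GRing.Theory Num.Theory.
Import numFieldNormedType.Exports.

Local Open Scope classical_set_scope.
Local Open Scope ring_scope.

(** All distances of the class are [alpha]-Lipschitz in each variable with respect
    to [D]. Hence uniform convergence on compact sets amounts to pointwise
    convergence [d_ n (x, y) --> d (x, y)], and each of the three
    Gamma-convergences is shown to be equivalent to the latter.

    Integrals. Constant sequences of measures are recovery sequences, by dominated
    convergence ([integral_cvg_dominated]). For the lower bound the integrand is
    truncated by functions with compact support that increase to 1
    ([integral_le_limn_einf], [exhausting_cutoffs]); they exist because a locally
    compact length space is separable ([separable_of_locally_compact]).
    Conversely, a recovery sequence for the Dirac mass at [(x, y)] concentrates
    there, which bounds [d_ n (x, y)] from above ([dirac_limn_esup]), and the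
    Dirac mass itself gives the lower bound.

    Nonexpansive functions. A recovery sequence for [u] is given by a perturbed
    McShane formula over a countable dense set ([lipschitz1_recovery]).
    Conversely, recovery of [d (x, _)] bounds [d_ n (x, y)] from below, and a limit
    point of the functions [d_ n (x, _)] bounds it from above.

    Lengths. The lower bound holds partition by partition. A recovery sequence for
    a curve in the closure consists of polygons in [Omega] whose edges are
    near-geodesics of [d_ n] ([near_recovery]). Conversely, recovery of a
    near-geodesic of [d] bounds [d_ n (x, y)] from above. For the lower bound,
    near-geodesics of [d_ n] from [x] to [y], run at almost constant speed
    ([near_geodesic]), must have a limit curve. This is where completeness and
    local compactness of [X] enter: along an ultrafilter, the times at which the
    curves converge form a clopen set ([ultrafilter_limit_of_curves]).

    In the two compactness arguments, limits along an ultrafilter are turned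
    into limits of sequences by [pseudo_intersection]: the Gamma-liminf inequality
    is applied to the sequence that follows the given one on the set of indices
    thus obtained and is equal to the limit elsewhere. *)

(** * Lower and upper limits, and extraction of sequences *)

Section lower_upper_limits.
Context {R : realType}.
Implicit Types (u : nat -> \bar R) (b : \bar R).
Local Open Scope ereal_scope.

Lemma le_limn_einf u b : (\forall n \near \oo, b <= u n) -> b <= limn_einf u.
Proof.
move=> bu; rewrite -[limn_einf u]/(limf_einf u \oo) limf_einfE.
apply: (@le_trans _ _ (ereal_inf (u @` [set n | b <= u n]))); last first.
  by apply: ereal_sup_ubound; exists [set n | b <= u n].
by apply: le_ereal_inf_tmp => _ [n /= bn <-].
Qed.

Lemma limn_esup_le u b : (\forall n \near \oo, u n <= b) -> limn_esup u <= b.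
Proof.
move=> ub; rewrite /limn_esup limf_esupE.
apply: (@le_trans _ _ (ereal_sup (u @` [set n | u n <= b]))).
  by apply: ereal_inf_lbound; exists [set n | u n <= b].
by apply: ge_ereal_sup => _ [n /= bn <-].
Qed.

Lemma limn_esup_lt_near u b : limn_esup u < b -> \forall n \near \oo, u n < b.
Proof.
rewrite /limn_esup limf_esupE => /ereal_inf_lt[_ [V oV <-] Vb].
apply: filterS oV => n Vn; apply: le_lt_trans Vb.
by apply: ereal_sup_ubound; exists n.
Qed.

Lemma limn_einf_le_frequently u b :
  (forall N, exists2 n, (N <= n)%N & u n <= b) -> limn_einf u <= b.
Proof.
move=> ub; rewrite -[limn_einf u]/(limf_einf u \oo) limf_einfE.
apply: ge_ereal_sup => _ [V [N _ NV] <-].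
have [n Nn unb] := ub N.
by apply: le_trans unb; apply: ereal_inf_lbound; exists n => //; exact: NV.
Qed.

Lemma lt_limn_einf_near u b : b < limn_einf u -> \forall n \near \oo, b < u n.
Proof.
move=> bu; apply: contrapT => nbu; move: bu; rewrite ltNge => /negP; apply.
apply: limn_einf_le_frequently => N; apply: contrapT => noN; apply: nbu.
by exists N => // n /= Nn; rewrite ltNge; apply/negP => unb; apply: noN; exists n.
Qed.

End lower_upper_limits.

Lemma not_near_frequently (P : nat -> Prop) : ~ (\forall n \near \oo, P n) ->
  forall N, exists2 n, (N <= n)%N & ~ P n.
Proof.
move=> nP N; apply: contrapT => noN; apply: nP; exists N => // n /= Nn.
by apply: contrapT => nPn; apply: noN; exists n.
Qed.

(** At index [n] take the largest [k <= n] for which some [x] is [good k n]. *)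
Lemma diagonal_sequence {T : Type} (x0 : T) (good : nat -> nat -> T -> Prop) :
  (forall k, \forall n \near \oo, exists x, good k n x) ->
  exists x_ : nat -> T,
    forall k, \forall n \near \oo, exists2 j, (k <= j)%N & good j n (x_ n).
Proof.
move=> good_ev.
have pick_n n : exists x, forall k, (k <= n)%N -> (exists y, good k n y) ->
    exists2 j, (k <= j)%N & good j n x.
  pose P k := `[< (k <= n)%N /\ exists y, good k n y >].
  have [[k0 Pk0]|noP] := pselect (exists k, P k); last first.
    by exists x0 => k kn gk; exfalso; apply: noP; exists k; apply/asboolP.
  have ubP k : P k -> (k <= n)%N by move=> /asboolP[].
  have [j /asboolP[jn [x gx]] jmax] := ex_maxnP (ex_intro _ k0 Pk0) ubP.
  exists x => k kn gk; exists j => //.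
  by apply: jmax; apply/asboolP.
have [x_ x_P] := choice pick_n.
exists x_ => k.
near=> n.
apply: x_P; last by near: n; exact: good_ev.
by near: n; exact: nbhs_infty_ge.
Unshelve. all: by end_near. Qed.

(** Collect, for each [k], an index [n_ k >= k] in [P 0], ..., [P k]: only
    finitely many of these indices can miss a given [P k]. Thus convergence
    along [U] becomes convergence along a sequence of indices. *)
Lemma pseudo_intersection (U : set_system nat) (P : nat -> set nat) :
  ProperFilter U -> \oo `<=` U -> (forall k, U (P k)) ->
  exists S : set nat, (forall N, exists2 n, (N <= n)%N & S n) /\
    (forall k, \forall n \near \oo, S n -> P k n).
Proof.
move=> PU ooU UP.
have UPk k : U [set n | forall j, (j <= k)%N -> P j n].
  elim: k => [|k IH].
    by apply: filterS (UP 0%N) => n Pn j; rewrite leqn0 => /eqP->.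
  apply: filterS2 IH (UP k.+1) => n Pn Pn1 j.
  by rewrite leq_eqVlt => /predU1P[->//|]; rewrite ltnS; exact: Pn.
have pick_k k : exists n, (k <= n)%N /\ forall j, (j <= k)%N -> P j n.
  have [n [kn Pn]] := filter_ex (filterI (ooU _ (nbhs_infty_ge k)) (UPk k)).
  by exists n.
have [n_ n_P] := choice pick_k.
exists (range n_); split.
  by move=> N; exists (n_ N); [exact: (n_P N).1 | exists N].
move=> k.
(* This sum is a simple bound for the indices n_ m with m < k. *)
exists (\sum_(j < k) (n_ j).+1)%N => // n /= ltn [m _ mn].
rewrite -mn; apply: (n_P m).2; rewrite leqNgt; apply/negP => mk.
move: ltn; rewrite -mn (bigD1 (Ordinal mk)) //= leqNgt => /negP; apply.
by rewrite addSn ltnS leq_addr.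
Qed.

Lemma frequent_ultrafilter (B : set nat) :
  (forall N, exists2 n, (N <= n)%N & B n) ->
  exists U : set_system nat, [/\ UltraFilter U, \oo `<=` U & U B].
Proof.
move=> freqB.
have PF : ProperFilter (within B \oo).
  apply: Build_ProperFilter_ex => P [N _ NP].
  by have [n Nn Bn] := freqB N; exists n; exact: NP.
have [U [ultraU sU]] := ultraFilterLemma PF.
exists U; split => //.
  by move=> P ooP; apply: sU; rewrite /within /=; apply: filterS ooP => n ? ?.
by apply: sU; exact: withinT.
Qed.

Lemma clopen_real_full {R : realType} (A : set R) (t0 : R) :
  A t0 -> open A -> closed A -> forall t, A t.
Proof.
move=> At0 oA cA t.
have cR : connected [set: R] by apply/connected_intervalP => x y _ _ z _.
suff -> : A = setT by [].
apply: cR; first by exists t0.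
  by exists A => //; rewrite setTI.
by exists A => //; rewrite setTI.
Qed.

(** * Arc length and near-geodesics *)

Section curves.
Context {R : realType}.

Definition unit_clamp (t : R) : R := Num.max 0 (Num.min t 1).

Lemma unit_clamp_itv t : 0 <= unit_clamp t <= 1.
Proof.
by rewrite /unit_clamp /Order.min; case: (ltP t 1) => ?;
  rewrite /Order.max; case: ltP => ?; lra. Qed.

Lemma unit_clamp_id t : 0 <= t <= 1 -> unit_clamp t = t.
Proof.
by rewrite /unit_clamp /Order.min; case: (ltP t 1) => ?;
  rewrite /Order.max; case: ltP => ?; lra. Qed.

Lemma unit_clamp_le0 t : t <= 0 -> unit_clamp t = 0.
Proof.
by rewrite /unit_clamp /Order.min; case: (ltP t 1) => ?;
  rewrite /Order.max; case: ltP => ?; lra. Qed.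

Lemma unit_clamp_ge1 t : 1 <= t -> unit_clamp t = 1.
Proof.
by rewrite /unit_clamp /Order.min; case: (ltP t 1) => ?;
  rewrite /Order.max; case: ltP => ?; lra. Qed.

Lemma unit_clamp_homo s t :
  s <= t -> 0 <= unit_clamp t - unit_clamp s <= t - s.
Proof.
move=> st; rewrite /unit_clamp /Order.min.
by case: (ltP t 1) => ?; case: (ltP s 1) => ?; rewrite /Order.max;
  do 2 case: ltP => ?; apply/andP; split; lra. Qed.

Lemma unit_clamp_dist s t : `|unit_clamp s - unit_clamp t| <= `|s - t|.
Proof.
wlog st : s t / s <= t => [hwlog|].
  case: (leP s t) => [/hwlog//|/ltW/hwlog].
  by rewrite distrC (distrC t).
have := unit_clamp_homo s t st.
rewrite distrC (distrC s) => /andP[cst0 cst].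
by rewrite !ger0_norm // subr_ge0.
Qed.

Lemma unit_clamp_mem t : `[0 : R, 1]%classic (unit_clamp t).
Proof. by rewrite /= in_itv /= unit_clamp_itv. Qed.

Definition unit_point (t : R) : `[0 : R, 1]%classic :=
  SigSub (mem_set (unit_clamp_mem t)).

Lemma val_unit_point t : 0 <= t <= 1 -> \val (unit_point t) = t.
Proof. exact: unit_clamp_id. Qed.

Lemma unit_point_itv (t : `[0 : R, 1]%classic) : 0 <= \val t <= 1.
Proof. by have := set_valP t; rewrite /= in_itv. Qed.

Lemma unit_pointK (t : `[0 : R, 1]%classic) : unit_point (\val t) = t.
Proof. by apply: val_inj; rewrite val_unit_point ?unit_point_itv. Qed.

Context {E : Type} {rho : E * E -> R} (rho_dist : is_distance rho).

Let rho_ge0 x y : 0 <= rho (x, y).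
Proof. by case: rho_dist. Qed.

Let rhoxx x : rho (x, x) = 0.
Proof. by case: rho_dist => _ rho0 _ _; exact/rho0. Qed.

Let rhoC x y : rho (x, y) = rho (y, x).
Proof. by case: rho_dist. Qed.

Let rho_triangle y x z : rho (x, z) <= rho (x, y) + rho (y, z).
Proof. by case: rho_dist. Qed.

(** The function [V] plays the role of arc length: the bounds telescope along
    every partition. *)
Lemma curve_length_le (gamma : `[0 : R, 1]%classic -> E) (V : R -> R) :
  (forall s t, \val s <= \val t ->
     rho (gamma s, gamma t) <= V (\val t) - V (\val s)) ->
  (curve_length rho gamma <= (V 1 - V 0)%:E)%E.
Proof.
move=> gammaV; apply: ge_ereal_sup => _ [k [t [[t0 tk t_incr] ->]]].
suff H m : (m <= k)%N ->
    \sum_(1 <= i < m.+1) rho (gamma (t i), gamma (t i.-1)) <=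
    V (\val (t m)) - V (\val (t 0%N)) by rewrite lee_fin; have := H k (leqnn k); rewrite tk t0.
elim: m => [_|m IH mk]; first by rewrite big_geq // subrr.
rewrite big_nat_recr //=.
have := IH (ltnW mk); have := gammaV _ _ (ltW (t_incr _ mk)).
rewrite rhoC; lra.
Qed.

Lemma sum_le_curve_length (gamma : `[0 : R, 1]%classic -> E) k t :
  partition_points k t ->
  ((\sum_(1 <= i < k.+1) rho (gamma (t i), gamma (t i.-1)))%:E <=
   curve_length rho gamma)%E.
Proof. by move=> tP; apply: ereal_sup_ubound; exists k, t. Qed.

Lemma endpoints_le_curve_length (gamma : `[0 : R, 1]%classic -> E) :
  ((rho (gamma (unit_point 1), gamma (unit_point 0)))%:E <=
   curve_length rho gamma)%E.
Proof.
pose t i := unit_point (i != 0)%N%:R.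
have tP : partition_points 1 t.
  by split => [||[]//]; rewrite !val_unit_point ?lexx ?ler01 //= ltr01.
by have := sum_le_curve_length gamma _ _ tP; rewrite big_nat1.
Qed.

(** The sums over partitions of the interval from 0 to [t], presented inductively so
    that one can add a last point to a partition and argue by induction on it. *)
Inductive inscribed (c : R -> E) : R -> R -> Prop :=
| inscribed0 : inscribed c 0 0
| inscribedS s t r : inscribed c s r -> s < t ->
    inscribed c t (r + rho (c s, c t)).

Lemma inscribed_ge0 c t r : inscribed c t r -> 0 <= t /\ 0 <= r.
Proof.
elim=> // s u a _ [s0 a0] su; split; last exact: addr_ge0.
by apply/ltW: (le_lt_trans s0 su).
Qed.

Lemma inscribed_partition (gamma : `[0 : R, 1]%classic -> E) t r :
  inscribed (gamma \o unit_point) t r -> t <= 1 ->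
  exists k (tau : nat -> `[0 : R, 1]%classic),
    [/\ \val (tau 0%N) = 0, \val (tau k) = t,
        forall i, (i < k)%N -> \val (tau i) < \val (tau i.+1) &
        \sum_(1 <= i < k.+1) rho (gamma (tau i), gamma (tau i.-1)) = r].
Proof.
elim=> [_|{}s {}t {}r insc IH st t1].
  exists 0%N, (fun=> unit_point 0); split=> //; last by rewrite big_geq.
    by rewrite val_unit_point ?lexx ?ler01.
  by rewrite val_unit_point ?lexx ?ler01.
have [s0 r0] := inscribed_ge0 _ _ _ insc.
have [k [tau [tau0 tauk tau_incr taur]]] := IH (ltW (lt_le_trans st t1)).
have t01 : 0 <= t <= 1 by rewrite t1 (le_trans s0 (ltW st)).
exists k.+1, (fun i => if (i <= k)%N then tau i else unit_point t); split=> //.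
- by rewrite /= ltnn val_unit_point.
- move=> i; rewrite ltnS => ik /=; rewrite ik.
  case: ltnP => ki; first exact: tau_incr.
  have -> : i = k by apply/eqP; rewrite eqn_leq ik.
  by rewrite tauk val_unit_point.
rewrite big_nat_recr //= ltnn leqnn -taur; congr (_ + _).
  rewrite [LHS]big_nat_cond [RHS]big_nat_cond; apply: eq_bigr => i.
  rewrite andbT ltnS => /andP[i1 ik]; rewrite ik.
  by rewrite (leq_trans (leq_pred i) ik).
by rewrite rhoC -tauk unit_pointK.
Qed.

Lemma inscribed_le_length (gamma : `[0 : R, 1]%classic -> E) t r :
  inscribed (gamma \o unit_point) t r -> t <= 1 ->
  (r%:E <= curve_length rho gamma)%E.
Proof.
wlog t1 : t r / t = 1 => [hwlog insc|].
  rewrite le_eqVlt => /predU1P[t1|t1]; first by apply: hwlog insc _ => //; rewrite t1.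
  apply: (@le_trans _ _ (r + rho ((gamma \o unit_point) t, (gamma \o unit_point) 1))%:E).
    by rewrite lee_fin lerDl.
  by apply: (hwlog 1) => //; exact: inscribedS insc t1.
rewrite t1 => /inscribed_partition insc /insc[k [tau [tau0 tau1 tau_incr <-]]].
exact: sum_le_curve_length.
Qed.

End curves.

Section near_geodesics.
Context {R : realType} {E : Type} {rho : E * E -> R}.
Hypothesis rho_dist : is_distance rho.

Let rho_ge0 x y : 0 <= rho (x, y).
Proof. by case: rho_dist. Qed.

Let rhoxx x : rho (x, x) = 0.
Proof. by case: rho_dist => _ rho0 _ _; exact/rho0. Qed.

Let rhoC x y : rho (x, y) = rho (y, x).
Proof. by case: rho_dist. Qed.

Let rho_triangle y x z : rho (x, z) <= rho (x, y) + rho (y, z).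
Proof. by case: rho_dist. Qed.

(** Let [V t] be the supremum of the inscribed sums up to [t], that is, the arc
    length. It increases at least by [rho] and is Lipschitz because [gamma] is,
    so that adding the small slope [e] makes it a strictly increasing
    continuous function, whose inverse is the wanted change of parameter. *)
Lemma arclength_reparametrization (gamma : `[0 : R, 1]%classic -> E) K L e :
  (forall s t, rho (gamma s, gamma t) <= K * `|\val s - \val t|) ->
  (curve_length rho gamma <= L%:E)%E -> 0 < e ->
  exists c : R -> E, [/\ c 0 = gamma (unit_point 0), c 1 = gamma (unit_point 1) &
    forall s t, rho (c s, c t) <= (L + e) * `|s - t|].
Proof.
wlog K0 : K / 0 <= K => [hwlog gammaK|gammaK gammaL e0].
  apply: (hwlog `|K|) => // s t; apply: le_trans (gammaK s t) _.
  by rewrite ler_wpM2r // ler_norm.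
pose c := gamma \o unit_point.
have inscL t r : inscribed (rho := rho) c t r -> t <= 1 -> r <= L.
  move=> insc t1; rewrite -lee_fin; apply: le_trans gammaL.
  exact: inscribed_le_length insc t1.
pose V t := sup [set r | inscribed (rho := rho) c t r].
have inscV t r : inscribed (rho := rho) c t r -> t <= 1 -> r <= V t.
  move=> insc t1; apply: sup_ubound => //.
  by exists L => a insc_a; exact: inscL insc_a t1.
have insc_ne t : 0 <= t -> exists r, inscribed (rho := rho) c t r.
  rewrite le_eqVlt => /predU1P[<-|t0]; first by exists 0; exact: inscribed0.
  by eexists; exact: inscribedS (inscribed0 _) t0.
have V_ge0 : 0 <= V 0 by apply: inscV; [exact: inscribed0 | exact: ler01].
have V_leL : V 1 <= L.
  apply: ge_sup => [|r insc]; last exact: inscL insc _.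
  by apply: insc_ne; exact: ler01.
have V_super s t : 0 <= s -> s < t -> t <= 1 -> V s + rho (c s, c t) <= V t.
  move=> s0 st t1; rewrite -lerBrDr; apply: ge_sup => [|r insc].
    exact: insc_ne.
  by rewrite lerBrDr; apply: inscV t1; exact: inscribedS insc st.
have cK s t : 0 <= s -> s <= t -> t <= 1 -> rho (c s, c t) <= K * (t - s).
  move=> s0 st t1; apply: (le_trans (gammaK _ _)).
  rewrite !val_unit_point; last 2 first.
  - by rewrite (le_trans s0 st).
  - by rewrite s0 (le_trans st t1).
  by rewrite distrC ger0_norm // subr_ge0.
(* By induction on the partition: if its last edge, from u to t, starts beyond s,
   it is dropped at the cost K * (t - u), and otherwise it is cut at s. *)
have V_lip s t : 0 <= s -> s < t -> t <= 1 -> V t <= V s + K * (t - s).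
  move=> s0 st t1; apply: ge_sup => [|r insc].
    by apply: insc_ne; exact/ltW/(le_lt_trans s0 st).
  have : s < t -> t <= 1 -> r <= V s + K * (t - s).
    elim: insc => {r t st t1} [s0' _|u t r insc IH ut st t1].
      by move: (le_lt_trans s0 s0'); rewrite ltxx.
    have [u0 _] := inscribed_ge0 rho_dist _ _ _ insc.
    have [us|su] := leP u s.
      have rVs : r + rho (c u, c s) <= V s.
        have [us'|su] := ltP u s.
          apply: inscV; first exact: inscribedS insc us'.
          exact/ltW/(lt_le_trans st t1).
        have -> : s = u by apply/eqP; rewrite eq_le us su.
        rewrite rhoxx addr0; apply: inscV => //.
        exact/ltW/(lt_le_trans ut t1).
      have := cK _ _ s0 (ltW st) t1; have := rho_triangle (c s) (c u) (c t).
      by lra.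
    have := IH su (ltW (lt_le_trans ut t1)).
    by have := cK _ _ u0 (ltW ut) t1; lra.
  exact.
pose W t := V t + e * t.
have W_lt s t : 0 <= s -> s < t -> t <= 1 ->
    rho (c s, c t) < W t - W s <= (K + e) * (t - s).
  move=> s0 st t1; rewrite /W.
  have e_st : 0 < e * (t - s) by rewrite mulr_gt0 // subr_gt0.
  have := V_super _ _ s0 st t1; have := V_lip _ _ s0 st t1.
  by move=> h1 h2; apply/andP; split; lra.
have W_dist s t : 0 <= s <= 1 -> 0 <= t <= 1 ->
    rho (c s, c t) <= `|W s - W t| <= (K + e) * `|s - t|.
  wlog : s t / s <= t => [hwlog|].
    case: (leP s t) => [|/ltW] st s01 t01; first exact: hwlog.
    by rewrite rhoC (distrC s) (distrC (W s)); exact: hwlog.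
  rewrite le_eqVlt => /predU1P[->|st] /andP[s0 _] /andP[_ t1].
    by rewrite !subrr normr0 mulr0 rhoxx lexx.
  have /andP[rW WK] := W_lt _ _ s0 st t1.
  rewrite distrC (distrC s) (gtr0_norm (_ : 0 < t - s)) ?subr_gt0 //.
  rewrite ger0_norm ?(ltW rW) //.
  exact/ltW/(le_lt_trans _ rW).
have W_cont : continuous (W \o unit_clamp).
  move=> t; apply/cvgrPdist_le => eps eps0.
  have Ke : 0 < K + e by rewrite ltr_wpDl.
  near=> s.
  have /andP[_ /le_trans] := W_dist _ _ (unit_clamp_itv t) (unit_clamp_itv s).
  apply; apply: (@le_trans _ _ ((K + e) * `|t - s|)).
    by apply: ler_wpM2l; [exact: ltW | exact: unit_clamp_dist].
  rewrite -ler_pdivlMl //; near: s.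
  by apply: (@cvgr_dist_le _ _ _ _ _ id t cvg_id); rewrite mulr_gt0 ?invr_gt0.
have /choice[sigma sigmaP] : forall r, exists s,
    0 <= s <= 1 /\ W s = W 0 + unit_clamp r * (W 1 - W 0).
  move=> r.
  have W01 : W 0 <= W 1.
    have /andP[+ _] := W_lt 0 1 (lexx _) ltr01 (lexx _).
    by move=> /(le_lt_trans (rho_ge0 _ _)); rewrite subr_gt0 => /ltW.
  have /andP[r0 r1] := unit_clamp_itv r.
  have [] := @IVT R (W \o unit_clamp) 0 1 (W 0 + unit_clamp r * (W 1 - W 0)) ler01.
  - exact: continuous_subspaceT.
  - rewrite /= unit_clamp_le0 // unit_clamp_ge1 // min_l // max_r //.
    by apply/andP; split; nra.
  - move=> t; rewrite in_itv /= => t01 Wt; exists t; split=> //.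
    by rewrite -Wt unit_clamp_id.
have sigma01 r : 0 <= sigma r <= 1 := (sigmaP r).1.
have Wsigma r := (sigmaP r).2.
have rhoW s t : 0 <= s <= 1 -> 0 <= t <= 1 -> rho (c s, c t) <= `|W s - W t|.
  by move=> s01 t01; have /andP[] := W_dist _ _ s01 t01.
have W_inj s t : 0 <= s <= 1 -> 0 <= t <= 1 -> W s = W t -> s = t.
  wlog : s t / s <= t => [hwlog|].
    case: (leP s t) => [|/ltW] st s01 t01; first exact: hwlog.
    by move=> /esym; move/(hwlog _ _ st t01 s01).
  rewrite le_eqVlt => /predU1P[->//|st] /andP[s0 _] /andP[_ t1] Wst.
  have /andP[+ _] := W_lt _ _ s0 st t1.
  by rewrite Wst subrr ltNge rho_ge0.
exists (c \o sigma); split=> /=.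
- rewrite /c /=; congr (gamma (unit_point _)); apply: W_inj; rewrite ?lexx ?ler01 //.
  by rewrite Wsigma unit_clamp_le0 // mul0r addr0.
- rewrite /c /=; congr (gamma (unit_point _)); apply: W_inj; rewrite ?lexx ?ler01 //.
  by rewrite Wsigma unit_clamp_ge1 // mul1r addrC subrK.
move=> s t; apply: (le_trans (rhoW _ _ (sigma01 s) (sigma01 t))).
have -> : W (sigma s) - W (sigma t) =
    (W 1 - W 0) * (unit_clamp s - unit_clamp t) by rewrite !Wsigma; ring.
rewrite normrM.
apply: ler_pM => //; last exact: unit_clamp_dist.
have /andP[+ _] := W_lt 0 1 (lexx _) ltr01 (lexx _).
move=> /(le_lt_trans (rho_ge0 _ _)) W01; rewrite gtr0_norm // /W; lra.
Unshelve. all: by end_near. Qed.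

(** The time spent on the first [k] edges of a polygon. *)
Lemma sum_unit_clamp k (t : R) :
  \sum_(i < k) unit_clamp (t - i%:R) = Num.max 0 (Num.min t k%:R).
Proof.
elim: k => [|k IH].
  by rewrite big_ord0 /Order.min; case: ltP => t0; rewrite /Order.max ?ltxx // ltNge (ltW t0).
rewrite big_ord_recr /= {}IH -natr1; have k0 : 0 <= k%:R :> R by [].
rewrite /unit_clamp /Order.min.
by case: (ltP t k%:R) => ?; case: (ltP (t - k%:R) 1) => ?; case: (ltP t (k%:R + 1)) => ?;
  rewrite /Order.max; do ?case: ltP => ?; lra.
Qed.

Lemma sum_unit_clamp_homo k (s t : R) : s <= t ->
  \sum_(i < k) (unit_clamp (t - i%:R) - unit_clamp (s - i%:R)) <= t - s.
Proof.
move=> st; rewrite sumrB !sum_unit_clamp /Order.min.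
have k0 : 0 <= k%:R :> R by [].
by case: (ltP t k%:R) => ?; case: (ltP s k%:R) => ?;
  rewrite /Order.max; do ?case: ltP => ?; lra.
Qed.

Hypothesis rho_length : is_length_space rho.

Lemma near_geodesic x y e : 0 < e ->
  exists c : R -> E, [/\ c 0 = x, c 1 = y &
    forall s t, rho (c s, c t) <= (rho (x, y) + e) * `|s - t|].
Proof.
move=> e0.
have [|_ [gamma [[K gammaK] [g0 g1]] <-] gammaL] := @ereal_inf_lt R
    [set curve_length rho gamma | gamma in
      [set gamma | Lipschitz_curve rho gamma /\ joins gamma x y]]
    (rho (x, y) + e / 2)%:E.
  by rewrite -rho_length lte_fin ltrDl divr_gt0.
have [c [c0 c1 cL]] := arclength_reparametrization gamma K _ (e / 2) gammaK
  (ltW gammaL) (divr_gt0 e0 (ltr0Sn _ 1)).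
exists c; split.
- by rewrite c0 g0 // val_unit_point ?lexx ?ler01.
- by rewrite c1 g1 // val_unit_point ?lexx ?ler01.
by move=> s t; have := cL s t; rewrite -addrA -splitr.
Qed.

(** Concatenating near-geodesics between consecutive vertices: on the edge from
    [p i] to [p i.+1] the speed is at most the length of the edge plus [e], and
    [unit_clamp (t - i%:R)] is the time spent on that edge up to time [t]. *)
Lemma near_geodesic_polygon (p : nat -> E) k e : 0 < e ->
  exists c : R -> E, (forall i, (i <= k)%N -> c i%:R = p i) /\
    forall s t, s <= t -> rho (c s, c t) <=
      \sum_(i < k) (rho (p i, p i.+1) + e) *
                   (unit_clamp (t - i%:R) - unit_clamp (s - i%:R)).
Proof.
move=> e0.
suff [c [cp _ cV]] : exists c : R -> E, [/\ forall i, (i <= k)%N -> c i%:R = p i,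
    forall t, k%:R <= t -> c t = p k &
    forall s t, s <= t -> rho (c s, c t) <=
      \sum_(i < k) (rho (p i, p i.+1) + e) *
                   (unit_clamp (t - i%:R) - unit_clamp (s - i%:R))].
  by exists c.
elim: k => [|k [c [cp cend cV]]].
  exists (fun=> p 0%N); split=> //; first by move=> i; rewrite leqn0 => /eqP->.
  by move=> s t _; rewrite rhoxx big_ord0.
have [b [b0 b1 bL]] := near_geodesic (p k) (p k.+1) e e0.
exists (fun t => if t <= k%:R then c t else b (unit_clamp (t - k%:R))).
split=> [i|t|s t st].
- rewrite leq_eqVlt ltnS => /predU1P[->|ik]; last by rewrite ler_nat ik cp.
  by rewrite ler_nat ltnn unit_clamp_ge1 // -natr1 addrC addKr.
- rewrite -natr1 => kt.
  rewrite leNgt (lt_le_trans _ kt) ?ltrDl //= unit_clamp_ge1 //; lra.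
have speed0 i : 0 <= rho (p i, p i.+1) + e by rewrite addr_ge0 // ltW.
have V_ge0 : 0 <= \sum_(i < k) (rho (p i, p i.+1) + e) *
                   (unit_clamp (t - i%:R) - unit_clamp (s - i%:R)).
  apply: sumr_ge0 => i _; apply: mulr_ge0 => //.
  have /andP[//] : 0 <= unit_clamp (t - i%:R) - unit_clamp (s - i%:R) <= t - i%:R - (s - i%:R).
  by apply: unit_clamp_homo; rewrite lerB.
rewrite big_ord_recr /=.
case: (leP t k%:R) => tk.
  rewrite (le_trans st tk).
  rewrite !(unit_clamp_le0 (_ - k%:R)) ?subrr ?mulr0 ?addr0 ?subr_le0 ?(le_trans st tk) //.
  exact: cV.
have b_bound : rho (b (unit_clamp (s - k%:R)), b (unit_clamp (t - k%:R))) <=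
    (rho (p k, p k.+1) + e) * (unit_clamp (t - k%:R) - unit_clamp (s - k%:R)).
  apply: (le_trans (bL _ _)); rewrite distrC ger0_norm //.
  have /andP[//] : 0 <= unit_clamp (t - k%:R) - unit_clamp (s - k%:R) <= t - k%:R - (s - k%:R).
  by apply: unit_clamp_homo; rewrite lerB.
case: (leP s k%:R) => sk; last by apply: (le_trans b_bound); rewrite lerDr.
apply: (le_trans (rho_triangle (p k) _ _)); apply: lerD.
  rewrite -(cend _ (lexx _)); apply: (le_trans (cV _ _ sk)).
  apply: ler_sum => i _; apply: ler_wpM2l => //; apply: lerB => //.
  have /andP[+ _] : 0 <= unit_clamp (t - i%:R) - unit_clamp (k%:R - i%:R) <= t - i%:R - (k%:R - i%:R).
    by apply: unit_clamp_homo; rewrite lerB // ltW.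
  by rewrite subr_ge0.
by move: b_bound; rewrite (unit_clamp_le0 (s - k%:R)) ?subr_le0 // b0.
Qed.

(** The polygon is run in unit time, with the time [1 / k] for each edge. Edges
    of length at most [M] bound both the speed and the distance to the last
    vertex passed. *)
Lemma near_geodesic_polygon_unit (p : nat -> E) k e M : (0 < k)%N -> 0 < e ->
  (forall i, (i < k)%N -> rho (p i, p i.+1) + e <= M) ->
  exists gamma : `[0 : R, 1]%classic -> E, [/\
    (curve_length rho gamma <=
       (\sum_(i < k) (rho (p i, p i.+1) + e))%:E)%E,
    forall s t, rho (gamma s, gamma t) <= M * k%:R * `|\val s - \val t| &
    forall i t, (i <= k)%N -> i%:R <= k%:R * \val t <= i.+1%:R ->
      rho (p i, gamma t) <= M].
Proof.
move=> k0 e0 pM.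
have k0R : 0 < k%:R :> R by rewrite ltr0n.
have [c [cp cV]] := near_geodesic_polygon p k e e0.
pose V t := \sum_(i < k) (rho (p i, p i.+1) + e) * unit_clamp (k%:R * t - i%:R).
have M0 : 0 <= M by rewrite (le_trans _ (pM 0%N k0)) // addr_ge0 // ltW.
have VB s t : V t - V s = \sum_(i < k) (rho (p i, p i.+1) + e) *
    (unit_clamp (k%:R * t - i%:R) - unit_clamp (k%:R * s - i%:R)).
  by rewrite /V -sumrB; apply: eq_bigr => i _; rewrite mulrBr.
have cM s t : s <= t -> rho (c s, c t) <= M * (t - s).
  move=> st; apply: (le_trans (cV _ _ st)).
  apply: (@le_trans _ _ (\sum_(i < k) M *
      (unit_clamp (t - i%:R) - unit_clamp (s - i%:R)))).
    apply: ler_sum => i _; apply: ler_wpM2r; last exact: pM.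
    have /andP[//] : 0 <= unit_clamp (t - i%:R) - unit_clamp (s - i%:R) <= t - i%:R - (s - i%:R).
    by apply: unit_clamp_homo; rewrite lerB.
  by rewrite -mulr_sumr; apply: ler_wpM2l => //; exact: sum_unit_clamp_homo.
exists (fun t => c (k%:R * \val t)); split.
- have -> : \sum_(i < k) (rho (p i, p i.+1) + e) = V 1 - V 0.
    rewrite VB; apply: eq_bigr => i _.
    rewrite mulr1 mulr0 unit_clamp_ge1; last first.
      by rewrite lerBrDl natr1 ler_nat.
    by rewrite unit_clamp_le0 ?subr0 ?mulr1 // sub0r oppr_le0.
  apply: (curve_length_le rho_dist _ V) => s t st; rewrite VB; apply: cV.
  by rewrite ler_wpM2l.
- move=> s t; wlog st : s t / \val s <= \val t => [hwlog|].
    case: (leP (\val s) (\val t)) => [|/ltW] st; first exact: hwlog.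
    by rewrite rhoC distrC; exact: hwlog.
  rewrite distrC ger0_norm ?subr_ge0 // -mulrA mulrBr; apply: cM.
  by rewrite ler_wpM2l.
move=> i t ik /andP[it ti].
rewrite -(cp i ik); apply: (le_trans (cM _ _ it)).
rewrite -[leRHS]mulr1; apply: ler_wpM2l => //.
by rewrite lerBlDl natr1.
Qed.

End near_geodesics.

(** * Metric spaces and separability *)

(** A subset carries the restricted distance, which makes both [Omega] and its
    closure metric spaces. *)
Section set_type_metric.
Context {R : realType} {X : metricType R} (A : set X).

Let mdist_set (x y : A) : R := mdist (\val x) (\val y).

Let mdist_set_ge0 x y : 0 <= mdist_set x y.
Proof. exact: mdist_ge0. Qed.

Let mdist_set_eq x y : mdist_set x y = 0 -> x = y.
Proof. by move=> /mdist_positivity /val_inj. Qed.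

Let ball_set (x : A) (e : R) : ball x e = [set y : A | mdist_set x y < e].
Proof.
by rewrite /ball /= /initial_ball ballEmdist.
Qed.

HB.instance Definition _ :=
  @PseudoMetric_isMetric.Build R (set_type A) mdist_set
    mdist_set_ge0 mdist_set_eq ball_set.
End set_type_metric.

Lemma positive_null_sequence (R : realType) : exists r_ : nat -> R,
  (forall n, 0 < r_ n) /\ forall e, 0 < e -> exists n, r_ n < e.
Proof.
exists (fun n => n.+1%:R^-1); split=> [n|e e0]; first by rewrite invr_gt0.
have [n _ /(_ n (leqnn n))] := near_infty_natSinv_lt (PosNum e0).
by exists n.
Qed.

Section metric_spaces.
Context {R : realType} {E : metricType R}.
Implicit Types x y z : E.

Lemma nbhs_mdist x (P : set E) :
  nbhs x P <-> exists2 e : R, 0 < e & forall y, mdist x y < e -> P y.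
Proof.
split=> [/nbhs_ballP[e e0 eP]|[e e0 eP]]; [|apply/nbhs_ballP]; exists e => // y.
  by move=> xy; apply: eP; rewrite ballEmdist.
by rewrite ballEmdist; exact: eP.
Qed.

Lemma closed_mdist_le x (e : R) : closed [set y | mdist x y <= e].
Proof.
move=> y cly; rewrite /= leNgt; apply/negP => exy.
have [|z /= [xz yz]] := cly [set z | mdist y z < mdist x y - e].
  by apply/nbhs_mdist; exists (mdist x y - e); rewrite ?subr_gt0.
have := metric_triangle x z y; rewrite (metric_sym z); lra.
Qed.

Lemma compact_finite_net (K : set E) (e : R) : compact K -> 0 < e ->
  exists s : seq E, forall x, K x -> exists2 p, p \in s & mdist p x < e.
Proof.
move=> /compact_near_coveringP covK e0.
pose F := filter_from [set: seq E] (fun s => [set s' : seq E | {subset s <= s'}]).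
have FF : Filter F.
  apply: filter_from_filter; first by exists [::].
  move=> s s' _ _; exists (s ++ s') => // r sr.
  by split=> p ps; apply: sr; rewrite mem_cat ps ?orbT.
have [x Kx|s _ sP] := covK _ F (fun (s : seq E) x => exists2 p, p \in s & mdist p x < e) FF.
  exists ([set y | mdist x y < e], [set s' : seq E | {subset [:: x] <= s'}]) => /=.
    split; first by apply/nbhs_mdist; exists e.
    by exists [:: x].
  move=> [y s] /= [xy xs]; exists x => //.
  by apply: xs; rewrite mem_seq1.
by exists s => x; apply: sP.
Qed.

(** From each point, move to any point of a finite net of a compact ball around it;
    the points reached in finitely many such moves are countably many, and their
    closure is clopen because a ball around a point of the closure is inside
    a compact ball around a reached point. *)
Lemma separable_of_locally_compact (x0 : E) :
  (forall x, exists2 e : R, 0 < e & compact [set y | mdist x y <= e]) ->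
  (forall x y, exists c : R -> E, [/\ continuous c, c 0 = x & c 1 = y]) ->
  exists q : nat -> E, forall x (e : R), 0 < e -> exists n, mdist (q n) x < e.
Proof.
move=> lcE pathE; have [r_ [r_gt0 r_lt]] := positive_null_sequence R.
have /choice[net netP] : forall xjk : E * nat * nat, exists s : seq E,
    let: (x, j, k) := xjk in compact [set y | mdist x y <= r_ j] ->
    forall y, mdist x y <= r_ j -> exists2 p, p \in s & mdist p y < r_ k.
  move=> [[x j] k].
  have [cpt|ncpt] := pselect (compact [set y | mdist x y <= r_ j]).
    have [|s sP] := compact_finite_net _ (r_ k) cpt; first exact: r_gt0.
    by exists s => _.
  by exists [::].
pose fix reach (w : seq (nat * nat * nat)) : E :=
  if w is (j, k, m) :: w' then nth x0 (net (reach w', j, k)) m else x0.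
pose A := [set y | forall e : R, 0 < e -> exists w, mdist (reach w) y < e].
have clA : closed A.
  move=> y cly e e0.
  have [|z /= [Az yz]] := cly [set z | mdist y z < e / 2].
    by apply/nbhs_mdist; exists (e / 2); rewrite ?divr_gt0.
  have [w wz] := Az _ (divr_gt0 e0 (ltr0Sn _ 1)).
  exists w; rewrite (splitr e) (le_lt_trans (metric_triangle _ z _)) // ltrD //.
  by rewrite metric_sym.
have opA : open A.
  rewrite openE => y Ay; apply/nbhs_mdist.
  have [e e0 cpt] := lcE y.
  have [j je] := r_lt _ (divr_gt0 e0 (ltr0Sn R 1)).
  have j0 : 0 < r_ j / 2 by rewrite divr_gt0.
  exists (r_ j / 2) => // z yz e' e'0.
  have [w wy] := Ay _ j0.
  have [k ke'] := r_lt _ e'0.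
  have /(netP (reach w, j, k))/(_ z)[] : compact [set y | mdist (reach w) y <= r_ j].
    apply: subclosed_compact cpt _; first exact: closed_mdist_le.
    move=> u /= wu; have := metric_triangle y (reach w) u.
    by rewrite (metric_sym y (reach w)); lra.
  - by have := metric_triangle (reach w) y z; lra.
  move=> p pnet pz; exists ((j, k, index p (net (reach w, j, k))) :: w) => /=.
  by rewrite nth_index //; exact: lt_trans ke'.
have Aall y : A y.
  have [c [cc c0 <-]] := pathE x0 y.
  have := @clopen_real_full R (c @^-1` A) 0; apply => //=.
  - by rewrite c0 => e e0; exists [::]; rewrite mdistxx.
  - by apply: open_comp opA => t _; exact: cc.
  - by apply: closed_comp clA => t _; exact: cc.
exists (fun n => if unpickle n is Some w then reach w else x0) => x e /(Aall x)[w wx].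
by exists (pickle w); rewrite pickleK.
Qed.

End metric_spaces.

(** * Convergence of functions and of measures *)

Lemma cvg_set_type {T : topologicalType} {A : set T} (x_ : nat -> A) (x : A) :
  x_ n @[n --> \oo] --> x <-> \val (x_ n) @[n --> \oo] --> \val x.
Proof.
split=> [xx|xx P [_ [[W oW <-] Wx WP]]].
  exact: (cvg_comp _ _ xx (@initial_continuous A T set_val x)).
have := xx W (open_nbhs_nbhs (conj oW Wx)).
by move=> xW; apply: (@filterS _ \oo _ _ _ _ xW) => n Wn; exact: WP.
Qed.

Section uniform_convergence.
Context {R : realType} {Z : choiceType} {V : pseudoMetricType R}.
Implicit Types (f : Z -> V).

Lemma cvg_uniform_onP (A : set Z) (f_ : nat -> Z -> V) f :
  {uniform A, f_ n @[n --> \oo] --> f} <->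
  forall e : R, 0 < e ->
    \forall n \near \oo, forall z, A z -> ball (f z) e (f_ n z).
Proof.
split=> [ff e e0|ff P].
  apply: (ff [set h | forall z, A z -> ball (f z) e (h z)]).
  apply/uniform_nbhs; exists [set vw | ball vw.1 e vw.2]; split=> //.
  exact: (entourage_ball V (PosNum e0)).
move=> /uniform_nbhs[W [+ WP]]; rewrite -entourage_ballE => -[e /= e0 eW].
apply: (@filterS _ \oo _ _ _ _ (ff e e0)) => n fn; apply: WP => z Az.
by apply: eW; exact: fn.
Qed.

Lemma cvg_uniformP (f_ : nat -> Z -> V) f :
  (f_ n : {uniform Z -> V}) @[n --> \oo] --> (f : {uniform Z -> V}) <->
  forall e : R, 0 < e -> \forall n \near \oo, forall z, ball (f z) e (f_ n z).
Proof.
rewrite -[X in X <-> _]/({uniform [set: Z], f_ n @[n --> \oo] --> f}).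
rewrite cvg_uniform_onP; split=> ff e /ff; apply: filterS => n + z.
  exact.
by move=> + _.
Qed.

End uniform_convergence.

Section compact_convergence.
Context {R : realType} {Z : topologicalType}.
Implicit Types (f : Z -> R).

Lemma cvg_family_compactP (f_ : nat -> Z -> R) f :
  (f_ n : {family compact, Z -> R}) @[n --> \oo] --> (f : {family compact, Z -> R})
  <-> forall K e, compact K -> 0 < e ->
    \forall n \near \oo, forall z, K z -> `|f z - f_ n z| < e.
Proof.
rewrite -[X in X <-> _]/({family compact, f_ n @[n --> \oo] --> f}).
split=> [/fam_cvgP ff K e cK e0|ff].
  by have /cvg_uniform_onP/(_ e e0) := ff K cK.
by apply/fam_cvgP => K cK; apply/cvg_uniform_onP => e e0; exact: ff.
Qed.

Lemma cvg_family_compact_pointwise (f_ : nat -> Z -> R) f :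
  (f_ n : {family compact, Z -> R}) @[n --> \oo] --> (f : {family compact, Z -> R})
  -> forall z, f_ n z @[n --> \oo] --> f z.
Proof.
move=> /cvg_family_compactP ff z; apply/cvgrPdist_lt => e e0.
by apply: (@filterS _ \oo _ _ _ _ (ff _ _ (@compact_set1 _ z) e0)) => n; exact.
Qed.

(** Near each point, equicontinuity makes the convergence uniform; compact sets
    are covered by finitely many such neighbourhoods. *)
Lemma equicontinuous_cvg_family_compact (f_ : nat -> Z -> R) f :
  (forall z e, 0 < e -> \forall z' \near z,
     `|f z - f z'| <= e /\ forall n, `|f_ n z - f_ n z'| <= e) ->
  (forall z, f_ n z @[n --> \oo] --> f z) ->
  (f_ n : {family compact, Z -> R}) @[n --> \oo] --> (f : {family compact, Z -> R}).
Proof.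
move=> equi ff; apply/cvg_family_compactP => K e /compact_near_coveringP covK e0.
have e4 : 0 < e / 4 by rewrite divr_gt0.
apply: (covK _ \oo (fun n z => `|f z - f_ n z| < e)) => z Kz.
exists ([set z' | `|f z - f z'| <= e / 4 /\ forall n, `|f_ n z - f_ n z'| <= e / 4],
        [set n | `|f z - f_ n z| < e / 4]) => /=.
  by split; [exact: equi | exact: (cvgr_dist_lt _ _ (ff z))].
move=> [z' n] /= [[fz' /(_ n) fnz'] fnz].
have -> : f z' - f_ n z' = (f z - f_ n z) - (f z - f z') + (f_ n z - f_ n z').
  by ring.
apply: (le_lt_trans (ler_normD _ _)); apply: (le_lt_trans (lerD (ler_normB _ _) (lexx _))).
lra.
Qed.

End compact_convergence.

Lemma cvg_weak_star {R : realType} {T : topologicalType} {t0 : T}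
    (mu_ : nat -> borel_measures R t0) (mu : borel_measures R t0) (f : T -> R) :
  mu_ n @[n --> \oo] --> mu -> Cc R T f ->
  (\int[mu_ n]_(x in setT) f x) @[n --> \oo] --> \int[mu]_(x in setT) f x.
Proof.
move=> mumu Ccf; have C0f : C0 R T f by exact: subset_closure.
pose F : C0 R T := SigSub (mem_set C0f).
have dmu : duality t0 (mu_ n) @[n --> \oo] --> duality t0 mu.
  exact: (cvg_comp _ _ mumu (@initial_continuous _ _ (duality t0) mu)).
exact: (cvg_comp _ _ dmu (@proj_continuous _ (fun _ : C0 R T => R) F _)).
Qed.

(** * Extension of a distance to the closure *)

Section lipschitz_on_pairs.
Context {R : realType} {E : metricType R}.

Lemma near_pair (z : E * E) (a e : R) : 0 <= a -> 0 < e ->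
  \forall z' \near z, a * (mdist z.1 z'.1 + mdist z.2 z'.2) <= e.
Proof.
move=> a0 e0; have a1 : 0 < a + 1 by rewrite ltr_wpDl.
pose r := e / 2 / (a + 1); have r0 : 0 < r by rewrite !divr_gt0.
exists ([set x | mdist z.1 x < r], [set y | mdist z.2 y < r]) => /=.
  by split; apply/nbhs_mdist; exists r.
move=> [x y] /= [zx zy].
have -> : e = (a + 1) * (r + r) by rewrite /r; field; rewrite gt_eqF.
by apply: ler_pM; rewrite ?addr_ge0 ?mdist_ge0 ?lerDl // lerD // ltW.
Qed.

Definition pair_lipschitz (a : R) (f : E * E -> R) := forall z z' : E * E,
  `|f z - f z'| <= a * (mdist z.1 z'.1 + mdist z.2 z'.2).

Lemma pair_lipschitz_near a f z e : 0 <= a -> pair_lipschitz a f -> 0 < e ->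
  \forall z' \near z, `|f z - f z'| <= e.
Proof.
by move=> a0 fa e0; apply: filterS (near_pair z a e a0 e0) => z'; apply: le_trans.
Qed.

Lemma pair_lipschitz_continuous a f : 0 <= a -> pair_lipschitz a f -> continuous f.
Proof.
by move=> a0 fa z; apply/cvgrPdist_le => e; exact: pair_lipschitz_near a0 fa.
Qed.

Lemma distance_pair_lipschitz a (d : E * E -> R) :
  is_distance d -> (forall z, d z <= a * mdist z.1 z.2) -> pair_lipschitz a d.
Proof.
move=> [_ _ dC d_triangle] dD.
have H x y x' y' : d (x, y) - d (x', y') <= a * (mdist x x' + mdist y y').
  have := d_triangle x x' y; have := d_triangle x' y' y.
  have /= := dD (x, x'); have /= := dD (y', y).
  by rewrite (metric_sym y'); lra.
move=> [x y] [x' y'] /=; rewrite ler_norml H andbT.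
by have := H x' y' x y; rewrite (metric_sym x') (metric_sym y'); lra.
Qed.

End lipschitz_on_pairs.

Section closure_of_a_set.
Context {R : realType} {X : metricType R} {Omega : set X}.

Lemma closure_approx (x : closure Omega) (e : R) : 0 < e ->
  exists p : Omega, mdist x (to_closure p) < e.
Proof.
move=> e0.
have [|p /= [Op xp]] := set_valP x [set y | mdist (\val x) y < e].
  by apply/nbhs_mdist; exists e.
by exists (SigSub (mem_set Op)).
Qed.

Lemma closure_pairs_dense (z : closure Omega * closure Omega) P :
  nbhs z P -> exists p q : Omega, P (to_closure p, to_closure q).
Proof.
move=> [[A B] /= [/nbhs_mdist[e e0 eA] /nbhs_mdist[e' e'0 eB]] ABP].
have [p xp] := closure_approx z.1 e e0.
have [q yq] := closure_approx z.2 e' e'0.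
by exists p, q; apply: ABP; split; [exact: eA | exact: eB].
Qed.

Context {a : R} {d : Omega * Omega -> R}.
Hypotheses (a0 : 0 <= a) (d_dist : is_distance d) (dD : forall z, d z <= a * mdist z.1 z.2).

Let lipschitz_extension (z : closure Omega * closure Omega) : R :=
  inf [set d pq + a * (mdist z.1 (to_closure pq.1) + mdist z.2 (to_closure pq.2)) |
        pq in [set: Omega * Omega]].

Let d_ge0 pq : 0 <= d pq.
Proof. by case: d_dist pq => + _ _ _ [p q]; exact. Qed.

Let bound_ge0 (z : closure Omega * closure Omega) pq :
  0 <= d pq + a * (mdist z.1 (to_closure pq.1) + mdist z.2 (to_closure pq.2)).
Proof.
by rewrite addr_ge0 // mulr_ge0 // addr_ge0 // mdist_ge0.
Qed.

(** McShane's formula defines a Lipschitz extension, and any other continuous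
    extension agrees with it by density; so the choice in [closure_extension]
    is determined and inherits the Lipschitz bound. *)
Lemma closure_extensionP :
  (forall x y : Omega, closure_extension d (to_closure x, to_closure y) = d (x, y))
  /\ pair_lipschitz a (closure_extension d).
Proof.
have ext_le z pq : lipschitz_extension z <=
    d pq + a * (mdist z.1 (to_closure pq.1) + mdist z.2 (to_closure pq.2)).
  apply: ge_inf; last by exists pq.
  by exists 0 => _ [pq' _ <-].
have le_ext (z : closure Omega * closure Omega) r :
    (forall pq, r <= d pq +
       a * (mdist z.1 (to_closure pq.1) + mdist z.2 (to_closure pq.2))) ->
    r <= lipschitz_extension z.
  move=> rle; apply: lb_le_inf; last by move=> _ [pq _ <-]; exact: rle.
  have [p [q _]] := closure_pairs_dense z setT filterT.
  by eexists; exists (p, q).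
have extE x y : lipschitz_extension (to_closure x, to_closure y) = d (x, y).
  apply/eqP; rewrite eq_le; apply/andP; split.
    by apply: (le_trans (ext_le _ (x, y))); rewrite /= !mdistxx addr0 mulr0 addr0.
  apply: le_ext => pq.
  have := distance_pair_lipschitz a d d_dist dD (x, y) pq.
  rewrite ler_norml => /andP[_]; rewrite lerBlDl; exact.
have ext_lip : pair_lipschitz a lipschitz_extension.
  have H z z' : lipschitz_extension z - lipschitz_extension z' <=
      a * (mdist z.1 z'.1 + mdist z.2 z'.2).
    rewrite lerBlDr addrC -lerBlDr; apply: le_ext => pq.
    rewrite lerBlDr; apply: (le_trans (ext_le _ pq)).
    have -> : d pq + a * (mdist z'.1 (to_closure pq.1) + mdist z'.2 (to_closure pq.2)) +
        a * (mdist z.1 z'.1 + mdist z.2 z'.2) =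
      d pq + a * ((mdist z.1 z'.1 + mdist z'.1 (to_closure pq.1)) +
                  (mdist z.2 z'.2 + mdist z'.2 (to_closure pq.2))) by ring.
    by rewrite lerD2l ler_wpM2l // lerD // metric_triangle.
  move=> z z'; rewrite ler_norml H andbT.
  by have := H z' z; rewrite (metric_sym z'.1) (metric_sym z'.2); lra.
have [ext_cont ext_d] : [set f | continuous f /\
    forall x y : Omega, f (to_closure x, to_closure y) = d (x, y)] (closure_extension d).
  apply: xgetPex; exists lipschitz_extension; split=> //.
  exact: pair_lipschitz_continuous a0 ext_lip.
split=> //.
suff -> : closure_extension d = lipschitz_extension by [].
apply/funext => z; apply/eqP; rewrite -subr_eq0 -normr_le0; apply/ler_addgt0Pl => e e0.
have e2 : 0 < e / 2 by rewrite divr_gt0.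
have [p [q [h1 h2]]] := closure_pairs_dense z _
  (filterI (cvgr_dist_le _ _ (ext_cont z) _ e2) (pair_lipschitz_near a _ z _ a0 ext_lip e2)).
move: h1 h2; rewrite /= ext_d extE addr0.
rewrite (distrC (lipschitz_extension z)) => h1 h2.
have -> : closure_extension d z - lipschitz_extension z =
  (closure_extension d z - d (p, q)) + (d (p, q) - lipschitz_extension z) by ring.
by apply: (le_trans (ler_normD _ _)); lra.
Qed.

End closure_of_a_set.

(** * Limits of equi-Lipschitz curves *)

Section limits_of_curves.
Context {R : realType} {X : metricType R}.

Lemma locally_compact_closed_ball (x : X) : locally_compact [set: X] ->
  exists2 e : R, 0 < e & compact [set y | mdist x y <= e].
Proof.
move=> /(_ x I); rewrite withinET => -[U /nbhs_mdist[e e0 eU] [cptU clU]].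
exists (e / 2); first by rewrite divr_gt0.
apply: subclosed_compact cptU _; first exact: closed_mdist_le.
by move=> y /= xy; apply: eU; apply: le_lt_trans xy _; rewrite gtr_pMr // invf_lt1 // ltr1n.
Qed.

(** The times at which the curves converge along the ultrafilter form a set that is
    closed by completeness and open by local compactness, because the curves are
    equi-Lipschitz; it contains 0, so that it is the whole line. *)
Lemma ultrafilter_limit_of_curves (U : set_system nat) (c : nat -> R -> X)
    (x : X) (M : R) :
  locally_compact [set: X] -> complete_space X -> UltraFilter U ->
  (forall n s t, mdist (c n s) (c n t) <= M * `|s - t|) ->
  (forall n, c n 0 = x) ->
  exists gamma : R -> X, forall t, c n t @[n --> U] --> gamma t.
Proof.
move=> lcX complX ultraU cM cx.
suff lim_c t : exists y : X, c n t @[n --> U] --> y.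
  by have [gamma gammaP] := choice lim_c; exists gamma.
move: t; pose A := [set t | exists y : X, c n t @[n --> U] --> y].
have M1 : 0 < `|M| + 1 by rewrite ltr_wpDl.
have cM1 n s t : mdist (c n s) (c n t) <= (`|M| + 1) * `|s - t|.
  apply: (le_trans (cM n s t)); apply: ler_wpM2r => //.
  by rewrite (le_trans (ler_norm _)) // lerDl.
have near_cU t (y : X) e : 0 < e -> c n t @[n --> U] --> y -> U [set n | mdist y (c n t) < e].
  move=> e0 cty; apply: (cty [set z | mdist y z < e]).
  by apply/nbhs_mdist; exists e.
apply: (@clopen_real_full R A 0).
- exists x => P Px; apply: (@filterS _ U _ setT); last exact: filterT.
  by move=> n _ /=; rewrite cx; exact: nbhs_singleton Px.
- rewrite openE => t [y cty].
  have [e e0 cpt] := locally_compact_closed_ball y lcX.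
  have e2 : 0 < e / 2 by rewrite divr_gt0.
  apply/nbhs_ballP; exists (e / 2 / (`|M| + 1)) => [|s]; first exact: divr_gt0.
  rewrite /ball /= ltr_pdivlMr // mulrC => ts.
  have [|z [_ /= cz]] := cpt (c^~ s @ U) (fmap_proper_filter _ _).
    rewrite /fmap /=; apply: (@filterS _ U _ _ _ _ (near_cU _ _ _ e2 cty)) => n /= yc.
    apply: (le_trans (metric_triangle _ (c n t) _)).
    by have := cM1 n t s; lra.
  exists z => P Pz.
  have [//|nUP] := in_ultra_setVsetC (c^~ s @^-1` P) ultraU.
  by have [w [/= nPw /nPw]] := cz (~` P) P nUP Pz.
move=> t clt.
have PF : ProperFilter (c^~ t @ U) by exact: fmap_proper_filter.
apply: (complX (c^~ t @ U)); apply/cauchyP => e e0.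
have e2 : 0 < e / 2 by rewrite divr_gt0.
have [|s [[y csy] ts]] := clt (ball t (e / 2 / (`|M| + 1))).
  by apply: nbhsx_ballx; exact: divr_gt0.
exists y; rewrite ballEmdist /fmap /=.
move: ts; rewrite /ball /= ltr_pdivlMr // mulrC => ts.
apply: (@filterS _ U _ _ _ _ (near_cU _ _ _ e2 csy)) => n /= yc.
apply: (le_lt_trans (metric_triangle _ (c n s) _)).
by have := cM1 n s t; rewrite distrC; lra.
Qed.

End limits_of_curves.

(** * Integrals and functions with compact support *)

Section compactly_supported_functions.
Context {R : realType} {T : topologicalType}.
Implicit Types f g : T -> R.

Lemma Cc_dominated f g : continuous f -> Cc R T g ->
  (forall x, g x = 0 -> f x = 0) -> Cc R T f.
Proof.
move=> cf [_ cptg] gf; split=> //.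
apply: subclosed_compact cptg _; first exact: closed_closure.
apply: closureS => x /=; apply: contra_neq; exact: gf.
Qed.

Lemma Cc0 : Cc R T (fun=> 0).
Proof.
split; first exact: cst_continuous.
rewrite (_ : [set x | _] = set0) ?closure0; first exact: compact0.
by apply/seteqP; split=> x //=; rewrite eqxx.
Qed.

Lemma CcD f g : Cc R T f -> Cc R T g -> Cc R T (fun x => f x + g x).
Proof.
move=> [cf cptf] [cg cptg]; split; first by move=> x; apply: cvgD; [exact: cf | exact: cg].
apply: subclosed_compact (compactU cptf cptg) _; first exact: closed_closure.
rewrite -closureU; apply: closureS => x /= fg0.
have [f0|] := eqVneq (f x) 0; last by left.
by right; move: fg0; rewrite f0 add0r.
Qed.

Lemma Cc_sum (I : Type) (r : seq I) (f_ : I -> T -> R) :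
  (forall i, Cc R T (f_ i)) -> Cc R T (fun x => \sum_(i <- r) f_ i x).
Proof.
move=> Ccf; elim: r => [|i r IH].
  rewrite (_ : (fun x => _) = fun=> 0); first exact: Cc0.
  by apply/funext => x; rewrite big_nil.
rewrite (_ : (fun x => _) = fun x => f_ i x + \sum_(j <- r) f_ j x); first exact: CcD.
by apply/funext => x; rewrite big_cons.
Qed.

Context {t0 : T}.

Lemma continuous_borel_measurable f : continuous f ->
  measurable_fun setT (f : borel_space t0 -> R).
Proof.
move=> /continuousP cf; apply: (measurability _ (RGenOpens.measurableE R)).
move=> _ [_ [a [b ->] <-]]; rewrite setTI; apply: sub_sigma_algebra.
exact/cf/interval_open.
Qed.

(** A compactly supported continuous function is bounded, and the measure is
    finite. *)
Lemma Cc_integrable (mu : borel_measures R t0) f : Cc R T f ->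
  mu.-integrable setT (EFin \o (f : borel_space t0 -> R)).
Proof.
move=> [cf cptf]; apply: measurable_bounded_integrable => //.
- rewrite -ge0_fin_numE //; exact: fin_num_measure.
- exact: continuous_borel_measurable.
have /compact_bounded[M [Mreal MP]] : compact (f @` closure [set x | f x != 0]).
  by apply: continuous_compact => //; exact: continuous_subspaceT.
exists (Num.max 0 M); split; first exact: num_real.
move=> N; rewrite gt_max => /andP[N0 MN] x _ /=.
have [->|fx0] := eqVneq (f x) 0; first by rewrite normr0 ltW.
by apply: (MP N MN); exists x => //; exact: subset_closure.
Qed.

Lemma EFin_Rintegral_Cc (mu : borel_measures R t0) f : Cc R T f ->
  ((\int[mu]_(x in setT) f x)%R%:E = \int[mu]_(x in setT) (f x)%:E)%E.
Proof.
move=> Ccf; rewrite /Rintegral fineK //.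
exact: integral_fune_fin_num (Cc_integrable mu f Ccf).
Qed.

Lemma Cc_le_integral (mu : borel_measures R t0) f g : Cc R T f -> continuous g ->
  (forall x, 0 <= f x <= g x) ->
  ((\int[mu]_(x in setT) f x)%R%:E <= \int[mu]_(x in setT) (g x)%:E)%E.
Proof.
move=> Ccf cg fg; rewrite EFin_Rintegral_Cc //; apply: ge0_le_integral => //.
- by move=> x _; rewrite lee_fin; have /andP[] := fg x.
- by apply/measurable_EFinP; apply: continuous_borel_measurable; case: Ccf.
- by apply/measurable_EFinP; exact: continuous_borel_measurable.
- by move=> x _; rewrite lee_fin; have /andP[] := fg x.
Qed.

(** Weak-star lower semicontinuity, jointly in the measure and the integrand: the
    truncations [h_ k * max (f - r_ k) 0] increase to [f] and, by uniform
    convergence on the support of [h_ k], are eventually below [f_ n]. *)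
Lemma integral_le_limn_einf (f_ : nat -> T -> R) f (h_ : nat -> T -> R)
    (mu_ : nat -> borel_measures R t0) (mu : borel_measures R t0) :
  (forall n, continuous (f_ n)) -> continuous f ->
  (forall n x, 0 <= f_ n x) -> (forall x, 0 <= f x) ->
  (f_ n : {family compact, T -> R}) @[n --> \oo] --> (f : {family compact, T -> R}) ->
  (forall k, Cc R T (h_ k)) -> (forall k x, 0 <= h_ k x <= 1) ->
  (forall x, {homo h_^~ x : k l / (k <= l)%N >-> k <= l}) ->
  (forall x, h_ k x @[k --> \oo] --> (1 : R)) ->
  mu_ n @[n --> \oo] --> mu ->
  (\int[mu]_(x in setT) (f x)%:E <=
     limn_einf (fun n => \int[mu_ n]_(x in setT) (f_ n x)%:E))%E.
Proof.
move=> cf_ cf f_ge0 f_ge0' ff Cch h01 h_incr h_lim mumu.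
pose r_ k : R := k.+1%:R^-1.
have r_gt0 k : 0 < r_ k by rewrite invr_gt0.
pose g_ k x := h_ k x * Num.max (f x - r_ k) 0.
have g_ge0 k x : 0 <= g_ k x.
  by rewrite mulr_ge0 //; [have /andP[] := h01 k x | rewrite le_max lexx orbT].
have g_cont k : continuous (g_ k).
  move=> x; apply: cvgM; first by have [+ _] := Cch k; exact.
  apply: (@continuous_max R T (fun y => f y - r_ k) (fun=> 0)); last exact: cvg_cst.
  by apply: cvgB; [exact: cf | exact: cvg_cst].
have Ccg k : Cc R T (g_ k).
  by apply: Cc_dominated (Cch k) _ => // x; rewrite /g_ => ->; rewrite mul0r.
have r_lim : r_ k @[k --> \oo] --> (0 : R) by exact: cvg_harmonic.
have g_lim x : g_ k x @[k --> \oo] --> f x.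
  rewrite -[f x]mul1r; apply: cvgM; first exact: h_lim.
  apply: (@squeeze_cvgr _ _ _ _ (fun k => f x - r_ k) (fun=> f x)); last 2 first.
  - by rewrite -[X in _ --> X]subr0; apply: cvgB => //; exact: cvg_cst.
  - exact: cvg_cst.
  apply: nearW => k; rewrite le_max lexx /= ge_max f_ge0' andbT.
  by rewrite gerBl ltW.
have g_incr x : {homo g_^~ x : k l / (k <= l)%N >-> k <= l}.
  move=> k l kl; apply: ler_pM; [|by rewrite le_max lexx orbT|exact: h_incr|].
    by have /andP[] := h01 k x.
  rewrite ge_max !le_max lexx orbT andbT; apply/orP; left.
  by rewrite lerB // lef_pV2 ?posrE // ler_nat.
have int_lim : (\int[mu]_(x in setT) (g_ k x)%:E @[k --> \oo] -->
    \int[mu]_(x in setT) (f x)%:E)%E.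
  have -> : (\int[mu]_(x in setT) (f x)%:E =
      \int[mu]_(x in setT) limn (fun k => (g_ k x)%:E))%E.
    apply: eq_integral => x _; apply/esym/cvg_lim => //.
    by apply: cvg_EFin; [exact: nearW | exact: g_lim].
  apply: (@cvg_monotone_convergence _ _ _ mu setT measurableT (fun k x => (g_ k x)%:E)).
  - by move=> k; apply/measurable_EFinP; exact: continuous_borel_measurable.
  - by move=> k x _; rewrite lee_fin.
  - by move=> x _ k l kl; rewrite lee_fin; exact: g_incr.
rewrite -(cvg_lim (@ereal_hausdorff R) int_lim); apply: lime_le.
  exact: cvgP int_lim.
near=> k; rewrite -EFin_Rintegral_Cc //.
have g_le : \forall n \near \oo, forall x, g_ k x <= f_ n x.
  have [_ cpth] := Cch k.
  move/cvg_family_compactP: ff => /(_ _ _ cpth (r_gt0 k)).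
  apply: filterS => n ffn x; rewrite /g_.
  have /andP[h0 h1] := h01 k x.
  have [->|hx] := eqVneq (h_ k x) 0; first by rewrite mul0r.
  have := ffn x (@subset_closure _ [set y | h_ k y != 0] x hx).
  rewrite ltr_norml => /andP[_ fn].
  have max0 : 0 <= Num.max (f x - r_ k) 0 by rewrite le_max lexx orbT.
  apply: (@le_trans _ _ (1 * Num.max (f x - r_ k) 0)); first exact: ler_wpM2r.
  by rewrite mul1r ge_max f_ge0 andbT; lra.
apply/lee_addgt0Pr => e e0.
rewrite -leeBlDr // -EFinB.
apply: le_limn_einf.
have /cvgrPdist_le/(_ e e0) := cvg_weak_star mu_ mu (g_ k) mumu (Ccg k).
apply: filterS2 g_le => n gn; rewrite ler_norml => /andP[_ gnn].
apply: (le_trans _ (Cc_le_integral (mu_ n) (g_ k) (f_ n) (Ccg k) (cf_ n) _)).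
  by rewrite lee_fin; lra.
by move=> x; rewrite g_ge0 gn.
Unshelve. all: by end_near. Qed.

(** Domination by [C * f] is only available if [f] is integrable; otherwise the
    right-hand side is infinite. *)
Lemma integral_cvg_dominated (f_ : nat -> T -> R) f (C : R)
    (mu : borel_measures R t0) :
  (forall n, continuous (f_ n)) -> continuous f ->
  (forall n x, 0 <= f_ n x <= C * f x) -> (forall x, 0 <= f x) ->
  (forall x, f_ n x @[n --> \oo] --> f x) ->
  (limn_esup (fun n => \int[mu]_(x in setT) (f_ n x)%:E) <=
     \int[mu]_(x in setT) (f x)%:E)%E.
Proof.
move=> cf_ cf f_C f0 ff.
have mf : measurable_fun setT (EFin \o (f : borel_space t0 -> R)).
  by apply/measurable_EFinP; exact: continuous_borel_measurable.
have [fin|] := ltP (\int[mu]_(x in setT) (f x)%:E)%E +oo%E; last first.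
  by rewrite leye_eq => /eqP ->; rewrite leey.
have intf : mu.-integrable setT (EFin \o (f : borel_space t0 -> R)).
  apply/integrableP; split=> //.
  by under eq_integral do rewrite /= ger0_norm //.
have [] := @dominated_convergence _ _ _ mu setT measurableT
  (fun n x => (f_ n x)%:E) (EFin \o f) (fun x => C%:E * (f x)%:E)%E.
- by move=> n; apply/measurable_EFinP; exact: continuous_borel_measurable.
- by [].
- by apply: aeW => x _; apply: cvg_EFin; [exact: nearW | exact: ff].
- exact: integrableZl.
- apply: aeW => x n _; have /andP[fn0 fnC] := f_C n x.
  by rewrite gee0_abs ?lee_fin.
by move=> _ _ /cvg_limn_einf_sup[_ ->].
Qed.

End compactly_supported_functions.

Section concentration.
Context {R : realType} {T : topologicalType}.

(** Testing against a bump function at [z]: as [mu_ n] tends to the Dirac mass,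
    its mass near [z] is almost 1, and there [f_ n] is at least [f_ n z - e]. *)
Lemma dirac_limn_esup (z : T) (f_ : nat -> T -> R) (l B : R)
    (mu_ : nat -> borel_measures R z) :
  (forall n, continuous (f_ n)) -> (forall n x, 0 <= f_ n x) ->
  (forall n, f_ n z <= B) ->
  (forall e, 0 < e -> exists chi : T -> R, [/\ Cc R T chi,
     forall x, 0 <= chi x <= 1, chi z = 1 &
     forall n x, chi x != 0 -> f_ n z - e <= f_ n x]) ->
  mu_ n @[n --> \oo] --> (\d_(z : borel_space z) : borel_measures R z) ->
  (limn_esup (fun n => \int[mu_ n]_(x in setT) (f_ n x)%:E) <= l%:E)%E ->
  forall e, 0 < e -> \forall n \near \oo, f_ n z <= l + e.
Proof.
move=> cf f0 fB bump mumu int_l e e0.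
have e4 : 0 < e / 4 by rewrite divr_gt0.
have B0 : 0 <= B by apply: le_trans (fB 0%N).
have B1 : 0 < B + 1 by rewrite ltr_wpDl.
have [chi [Ccchi chi01 chiz chif]] := bump _ e4.
have [chi_cont _] := Ccchi.
have chi_lim : \int[mu_ n]_(x in setT) chi x @[n --> \oo] --> (1 : R).
  have <- : \int[(\d_(z : borel_space z) : borel_measures R z)]_(x in setT) chi x = 1.
    apply: EFin_inj; rewrite EFin_Rintegral_Cc // integral_dirac //.
      by rewrite diracT mul1e chiz.
    by apply/measurable_EFinP; exact: continuous_borel_measurable.
  exact: cvg_weak_star.
have d0 : 0 < e / 4 / (B + 1) by rewrite divr_gt0.
have int_lt : (limn_esup (fun n => \int[mu_ n]_(x in setT) (f_ n x)%:E) < (l + e / 4)%:E)%E.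
  by apply: le_lt_trans int_l _; rewrite lte_fin ltrDl.
have := limn_esup_lt_near _ _ int_lt.
apply: filterS2 (cvgr_dist_le _ _ chi_lim _ d0) => n /ler_normlW chi_n int_n.
(* The positive part keeps the test function a * chi nonnegative. *)
pose a := Num.max (f_ n z - e / 4) 0.
have a0 : 0 <= a by rewrite le_max lexx orbT.
have aB : a <= B by rewrite ge_max B0 andbT; have := fB n; lra.
have fa : f_ n z - e / 4 <= a by rewrite le_max lexx.
have a_int : a * \int[mu_ n]_(x in setT) chi x <= l + e / 4.
  rewrite -lee_fin; apply: le_trans (ltW int_n).
  rewrite -RintegralZl //; last exact: Cc_integrable.
  apply: Cc_le_integral => //.
    apply: Cc_dominated Ccchi _ => [x|x ->]; last by rewrite mulr0.
    by apply: cvgM; [exact: cvg_cst | exact: chi_cont].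
  move=> x; have /andP[chi0 chi1] := chi01 x; rewrite mulr_ge0 //=.
  have [->|chix] := eqVneq (chi x) 0; first by rewrite mulr0.
  apply: (@le_trans _ _ (a * 1)); first exact: ler_wpM2l.
  by rewrite mulr1 ge_max f0 andbT; exact: chif.
have : a * (1 - \int[mu_ n]_(x in setT) chi x) <= e / 4.
  apply: (@le_trans _ _ (a * (e / 4 / (B + 1)))); first exact: ler_wpM2l.
  have -> : e / 4 = (B + 1) * (e / 4 / (B + 1)) by field; rewrite gt_eqF.
  rewrite [X in a * X](_ : _ = e / 4 / (B + 1)); last by field; rewrite gt_eqF.
  by apply: ler_wpM2r; [exact: ltW | lra].
by rewrite mulrBr mulr1; lra.
Qed.

End concentration.

Section cutoff_functions.
Context {R : realType} {E : metricType R}.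

Let bump (x : E) (r : R) (y : E) : R := Num.max 0 (1 - mdist x y / r).

Let bump_cont x r : continuous (bump x r).
Proof.
move=> y; apply: (@continuous_max R E (fun=> 0) (fun y => 1 - mdist x y / r)).
  exact: cvg_cst.
apply: cvgB; first exact: cvg_cst.
apply: cvgMl; apply/cvgrPdist_le => e e0; apply/nbhs_mdist; exists e => // y' yy'.
have := metric_triangle x y y'; have := metric_triangle x y' y.
by rewrite (metric_sym y' y) ler_norml => ? ?; apply/andP; split; lra.
Qed.

Let bump01 x r y : 0 < r -> 0 <= bump x r y <= 1.
Proof.
move=> r0; rewrite /bump le_max lexx ge_max ler01 /= gerBl.
by rewrite divr_ge0 ?mdist_ge0 // ltW.
Qed.

Let bump_gt0 x r y : 0 < r -> (0 < bump x r y) = (mdist x y < r).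
Proof.
by move=> r0; rewrite /bump lt_max ltxx /= subr_gt0 ltr_pdivrMr // mul1r.
Qed.

Definition pair_bump (z : E * E) (r : R) (w : E * E) : R :=
  bump z.1 r w.1 * bump z.2 r w.2.

Lemma pair_bump01 z r w : 0 < r -> 0 <= pair_bump z r w <= 1.
Proof.
move=> r0; have /andP[? ?] := bump01 z.1 r w.1 r0.
have /andP[? ?] := bump01 z.2 r w.2 r0.
by rewrite mulr_ge0 //= mulr_ile1.
Qed.

Lemma pair_bump_center z r : pair_bump z r z = 1.
Proof.
by rewrite /pair_bump /bump !mdistxx !mul0r !subr0 !(max_idPr _) ?mulr1.
Qed.

Lemma pair_bump_gt0 z r w : 0 < r ->
  (0 < pair_bump z r w) = (mdist z.1 w.1 < r) && (mdist z.2 w.2 < r).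
Proof.
move=> r0; rewrite -!bump_gt0 //.
have /andP[b1 _] := bump01 z.1 r w.1 r0; have /andP[b2 _] := bump01 z.2 r w.2 r0.
apply/idP/andP => [|[? ?]]; last exact: mulr_gt0.
rewrite /pair_bump lt0r mulf_eq0 negb_or => /andP[/andP[n1 n2] _].
by rewrite !lt0r n1 n2 b1 b2.
Qed.

Lemma pair_bump_Cc z r : 0 < r ->
  compact [set x | mdist z.1 x <= r] -> compact [set x | mdist z.2 x <= r] ->
  Cc R (E * E)%type (pair_bump z r).
Proof.
move=> r0 cpt1 cpt2; split.
  move=> w; apply: cvgM.
    by apply: (cvg_comp _ _ cvg_fst); exact: bump_cont.
  by apply: (cvg_comp _ _ cvg_snd); exact: bump_cont.
apply: subclosed_compact (compact_setX cpt1 cpt2) _; first exact: closed_closure.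
have clK : closed ([set x | mdist z.1 x <= r] `*` [set x | mdist z.2 x <= r]).
  apply: closedI.
    apply: (@closed_comp _ _ fst [set x | mdist z.1 x <= r]); last exact: closed_mdist_le.
    by move=> w _; exact: cvg_fst.
  apply: (@closed_comp _ _ snd [set x | mdist z.2 x <= r]); last exact: closed_mdist_le.
  by move=> w _; exact: cvg_snd.
have /closure_id -> := clK; apply: closureS => w /= w0.
have /andP[b0 _] := pair_bump01 z r w r0.
have : 0 < pair_bump z r w by rewrite lt0r w0.
by rewrite pair_bump_gt0 // => /andP[/ltW ? /ltW ?].
Qed.

(** Separability makes countably many bumps enough to have one positive at each
    point; their partial sums, multiplied by [k] and capped at 1, exhaust. *)
Lemma exhausting_cutoffs (q : nat -> E) :
  (forall x : E, exists2 e : R, 0 < e & compact [set y | mdist x y <= e]) ->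
  (forall (x : E) (e : R), 0 < e -> exists n, mdist (q n) x < e) ->
  exists h_ : nat -> E * E -> R, [/\ forall k, Cc R (E * E)%type (h_ k),
    forall k w, 0 <= h_ k w <= 1,
    forall w, {homo h_^~ w : k l / (k <= l)%N >-> k <= l} &
    forall w, h_ k w @[k --> \oo] --> (1 : R)].
Proof.
move=> lcE q_dense; have [r_ [r_gt0 r_lt]] := positive_null_sequence R.
pose cptb (x : E) j := `[< compact [set y | mdist x y <= r_ j] >].
pose psi i : E * E -> R := if @unpickle (nat * nat * nat)%type i is Some (n, m, j) then
  if cptb (q n) j && cptb (q m) j then pair_bump (q n, q m) (r_ j) else fun=> 0
  else fun=> 0.
have psi_Cc i : Cc R (E * E)%type (psi i).
  rewrite /psi; case: unpickle => [[[n m] j]|]; last exact: Cc0.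
  case: ifP => [/andP[/asboolP ? /asboolP ?]|_]; last exact: Cc0.
  exact: pair_bump_Cc.
have psi_ge0 i w : 0 <= psi i w.
  rewrite /psi; case: unpickle => [[[n m] j]|] //; case: ifP => // _.
  by have /andP[] := pair_bump01 (q n, q m) (r_ j) w (r_gt0 j).
have psi_gt0 w : exists i, 0 < psi i w.
  have [e e0 cpt] := lcE w.1; have [e' e'0 cpt'] := lcE w.2.
  have ee0 : 0 < Num.min e e' / 2 by rewrite divr_gt0 // lt_min e0.
  have [j] := r_lt _ ee0; rewrite ltr_pdivlMr // lt_min => /andP[je je'].
  have [n qn] := q_dense w.1 _ (r_gt0 j); have [m qm] := q_dense w.2 _ (r_gt0 j).
  exists (pickle (n, m, j)); rewrite /psi pickleK ifT.
    by rewrite pair_bump_gt0 //= qn qm.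
  apply/andP; split; apply/asboolP.
    apply: subclosed_compact cpt _; first exact: closed_mdist_le.
    move=> y /= qy; have := metric_triangle w.1 (q n) y.
    by rewrite (metric_sym w.1 (q n)); lra.
  apply: subclosed_compact cpt' _; first exact: closed_mdist_le.
  move=> y /= qy; have := metric_triangle w.2 (q m) y.
  by rewrite (metric_sym w.2 (q m)); lra.
pose s k w : R := k%:R * \sum_(i <- iota 0 k) psi i w.
have s_ge0 k w : 0 <= s k w by rewrite mulr_ge0 // sumr_ge0.
have s_homo w k l : (k <= l)%N -> s k w <= s l w.
  move=> kl; apply: ler_pM; rewrite ?sumr_ge0 ?ler_nat //.
  by rewrite -{1}(subnKC kl) iotaD big_cat /= lerDl sumr_ge0.
have Cc_s k : Cc R (E * E)%type (s k).
  have Ccs := Cc_sum _ (iota 0 k) psi psi_Cc; have [cs _] := Ccs.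
  apply: Cc_dominated Ccs _ => [w|w s0]; last by rewrite /s s0 mulr0.
  by apply: cvgM; [exact: cvg_cst | exact: cs].
exists (fun k w => Num.min (s k w) 1); split.
- move=> k; apply: Cc_dominated (Cc_s k) _ => w.
    apply: (@continuous_min R _ (s k) (fun=> 1)); last exact: cvg_cst.
    by case: (Cc_s k) => + _; exact.
  by move=> ->; rewrite min_l.
- by move=> k w; rewrite le_min s_ge0 ler01 ge_min lexx orbT.
- move=> w k l kl; rewrite le_min !ge_min lexx orbT andbT s_homo //.
move=> w; have [i psi_i] := psi_gt0 w.
apply: cvg_near_cst; near=> k; apply/min_idPr.
have ik : (i < k)%N by near: k; exact: nbhs_infty_gt.
apply: (@le_trans _ _ (k%:R * psi i w)).
  rewrite -ler_pdivrMr // mul1r; apply: ltW; near: k; exact: nbhs_infty_gtr.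
apply: ler_wpM2l => //; rewrite (bigD1_seq i) ?iota_uniq ?mem_iota //=.
by rewrite lerDl sumr_ge0.
Unshelve. all: by end_near. Qed.

End cutoff_functions.

(** * Pointwise convergence and the integral functionals *)

Section distances_and_measures.
Context {R : realType} {X : metricType R}.
Hypothesis X_loc_compact : locally_compact [set: X].
Context {alpha : R} (alpha_gt1 : 1 < alpha) {Omega : set X} (Omega_open : open Omega).

Let alpha_gt0 : 0 < alpha.
Proof. exact: lt_trans ltr01 alpha_gt1. Qed.

Let alpha_ge0 : 0 <= alpha.
Proof. exact: ltW. Qed.

Implicit Types d : length_distances alpha Omega.

Lemma length_distances_distance d : is_distance (\val d).
Proof. by case: (set_valP d). Qed.

Lemma length_distances_length_space d : is_length_space (\val d).
Proof. by case: (set_valP d). Qed.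

Lemma length_distances_le d z : \val d z <= alpha * mdist z.1 z.2.
Proof. by case: (set_valP d) => _ _ /(_ z)/andP[]. Qed.

Lemma mdist_le_length_distances d x y : mdist x y <= alpha * \val d (x, y).
Proof.
by case: (set_valP d) => _ _ /(_ (x, y))/andP[+ _]; rewrite ler_pdivrMl.
Qed.

Lemma length_distances_ge0 d z : 0 <= \val d z.
Proof. by case: z => x y; case: (length_distances_distance d). Qed.

Lemma length_distances_lipschitz d : pair_lipschitz alpha (\val d).
Proof.
exact: distance_pair_lipschitz (length_distances_distance d) (length_distances_le d).
Qed.

Lemma length_distances_continuous d : continuous (\val d : Omega * Omega -> R).
Proof.
exact: pair_lipschitz_continuous alpha_ge0 (length_distances_lipschitz d).
Qed.

(** A closed ball of [X] that is compact and inside [Omega] is compact in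
    [Omega]: a filter on it clusters in [X] at a point of that ball. *)
Lemma open_locally_compact (x : Omega) :
  exists2 e : R, 0 < e & compact [set y : Omega | mdist x y <= e].
Proof.
have [e e0 cpt] := locally_compact_closed_ball (\val x) X_loc_compact.
have /nbhs_mdist[e' e'0 ballO] : nbhs (\val x) Omega.
  by apply: open_nbhs_nbhs; split=> //; exact: set_valP.
exists (Num.min e (e' / 2)); first by rewrite lt_min e0 divr_gt0.
move=> F PF FB.
have [|p [/= xp clp]] := cpt (\val @ F) (fmap_proper_filter _ _).
  by apply: (@filterS _ F _ _ _ _ FB) => y; rewrite /= le_min => /andP[].
have [xp' Op] : mdist (\val x) p <= e' / 2 /\ Omega p.
  have xp' : mdist (\val x) p <= e' / 2.
    rewrite leNgt; apply/negP => e'p.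
    have [||y [/= xy py]] := clp [set y | mdist (\val x) y <= e' / 2]
       [set y | mdist p y < mdist (\val x) p - e' / 2].
    - by apply: (@filterS _ F _ _ _ _ FB) => y; rewrite /= le_min => /andP[].
    - by apply/nbhs_mdist; exists (mdist (\val x) p - e' / 2); rewrite ?subr_gt0.
    by have := metric_triangle (\val x) y p; rewrite (metric_sym y p); lra.
  by split=> //; apply: ballO; lra.
exists (SigSub (mem_set Op)); split; first by rewrite /= le_min xp.
move=> A B FA /nbhs_mdist[r r0 rB].
have [||y [[a Aa <-] /= pa]] := clp (\val @` A) [set y | mdist p y < r].
- by apply: (@filterS _ F _ _ _ _ FA) => a Aa; exists a.
- by apply/nbhs_mdist; exists r.
by exists a; split=> //; exact: rB.
Qed.

Lemma lipschitz_curve_continuous (c : R -> Omega) M :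
  (forall s t, mdist (c s) (c t) <= M * `|s - t|) -> continuous c.
Proof.
move=> cM t; have M1 : 0 < `|M| + 1 by rewrite ltr_wpDl.
move=> P /nbhs_mdist[e e0 eP]; apply/nbhs_ballP; exists (e / (`|M| + 1)) => [|s].
  exact: divr_gt0.
rewrite /ball /= ltr_pdivlMr // mulrC => ts; apply: eP.
apply: le_lt_trans (cM t s) (le_lt_trans _ ts); apply: ler_wpM2r => //.
by rewrite (le_trans (ler_norm _)) // lerDl.
Qed.

Lemma near_geodesic_ambient d x y e : 0 < e -> exists c : R -> Omega,
  [/\ c 0 = x, c 1 = y,
      forall s t, \val d (c s, c t) <= (\val d (x, y) + e) * `|s - t| &
      forall s t, mdist (c s) (c t) <= alpha * (\val d (x, y) + e) * `|s - t|].
Proof.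
move=> e0; have [c [c0 c1 cd]] := near_geodesic (length_distances_distance d)
  (length_distances_length_space d) x y e e0.
exists c; split=> // s t; apply: (le_trans (mdist_le_length_distances d _ _)).
by rewrite -mulrA; apply: ler_wpM2l.
Qed.

(** Near-geodesics connect any two points of [Omega]. *)
Lemma Omega_separable d (x0 : Omega) :
  exists q : nat -> Omega, forall (x : Omega) (e : R), 0 < e ->
    exists n, mdist (q n) x < e.
Proof.
apply: (separable_of_locally_compact x0 open_locally_compact) => x y.
have [c [c0 c1 _ cM]] := near_geodesic_ambient d x y 1 ltr01.
by exists c; split=> //; exact: lipschitz_curve_continuous cM.
Qed.

Context (d_ : nat -> length_distances alpha Omega) (d : length_distances alpha Omega).

(** The condition with which each of the four conditions of the theorem is
    compared. *)
Definition pointwise_cvg := forall z, \val (d_ n) z @[n --> \oo] --> \val d z.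

Lemma pointwise_cvgP : pointwise_cvg <->
  forall x y e, 0 < e ->
    (\forall n \near \oo, \val (d_ n) (x, y) <= \val d (x, y) + e) /\
    (\forall n \near \oo, \val d (x, y) <= \val (d_ n) (x, y) + e).
Proof.
split=> [pw x y e e0|H [x y]].
  have /cvgrPdist_le/(_ e e0) h := pw (x, y).
  by split; apply: (@filterS _ \oo _ _ _ _ h) => n; rewrite ler_norml => /andP[]; lra.
apply/cvgrPdist_le => e e0; have [h1 h2] := H x y e e0.
by apply: filterS2 h1 h2 => n ? ?; rewrite ler_norml; apply/andP; split; lra.
Qed.

Lemma length_distances_cvgP : d_ n @[n --> \oo] --> d <-> pointwise_cvg.
Proof.
rewrite cvg_set_type; split; first exact: cvg_family_compact_pointwise.
move=> pw; apply: equicontinuous_cvg_family_compact => // z e e0.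
apply: filterS (near_pair z alpha e alpha_ge0 e0) => z' zz'.
by split=> [|n]; apply: le_trans zz'; exact: length_distances_lipschitz.
Qed.

Lemma J_Gamma_cvg (z0 : Omega * Omega) : pointwise_cvg ->
  Gamma_cvg (fun n => J_ z0 (d_ n)) (J_ z0 d).
Proof.
move=> pw mu; split=> [mu_ mumu|].
  have [q q_dense] := Omega_separable d z0.1.
  have [h_ [Cch h01 h_incr h_lim]] := exhausting_cutoffs q open_locally_compact q_dense.
  apply: (integral_le_limn_einf (fun n => \val (d_ n)) (\val d) h_) => //.
  - by move=> n; exact: length_distances_continuous.
  - exact: length_distances_continuous.
  - by move=> n z; exact: length_distances_ge0.
  - by move=> z; exact: length_distances_ge0.
  - by have /length_distances_cvgP/cvg_set_type := pw.
exists (fun=> mu); first exact: cvg_cst.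
apply: (integral_cvg_dominated _ _ (alpha * alpha)) => //.
- by move=> n; exact: length_distances_continuous.
- exact: length_distances_continuous.
- move=> n [x y]; rewrite length_distances_ge0 /= -mulrA.
  apply: (le_trans (length_distances_le _ _)); apply: ler_wpM2l => //.
  exact: mdist_le_length_distances.
- by move=> z; exact: length_distances_ge0.
Qed.

(** The lower bound is the liminf inequality for the constant sequence of Dirac
    masses at [(x, y)], the upper bound comes from a recovery sequence for that
    mass. *)
Lemma pointwise_cvg_of_J :
  (forall z0 : Omega * Omega, Gamma_cvg (fun n => J_ z0 (d_ n)) (J_ z0 d)) ->
  pointwise_cvg.
Proof.
move=> GJ; apply/pointwise_cvgP => x y e e0; set z := (x, y).
have [J_inf [mu_ mu_cvg J_sup]] := GJ z (\d_(z : borel_space z) : borel_measures R z).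
have J_dirac d' : J_ z d' (\d_(z : borel_space z) : borel_measures R z) = (\val d' z)%:E.
  rewrite /J_ integral_dirac ?diracT ?mul1e //.
  by apply/measurable_EFinP; apply: continuous_borel_measurable; exact: length_distances_continuous.
rewrite J_dirac in J_sup; split.
  apply: (dirac_limn_esup z (fun n => \val (d_ n)) _ (alpha * mdist x y) mu_) e e0 => //.
  - by move=> n; exact: length_distances_continuous.
  - by move=> n w; exact: length_distances_ge0.
  - by move=> n; exact: length_distances_le.
  move=> e e0.
  have [a a0 cpta] := open_locally_compact x; have [b b0 cptb] := open_locally_compact y.
  pose r := Num.min (Num.min a b) (e / (2 * alpha)).
  have r0 : 0 < r by rewrite !lt_min a0 b0 divr_gt0 // mulr_gt0.
  exists (pair_bump z r); split.
  - apply: pair_bump_Cc => //.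
      apply: subclosed_compact cpta _; first exact: closed_mdist_le.
      by move=> u; rewrite /= !le_min => /andP[/andP[]].
    apply: subclosed_compact cptb _; first exact: closed_mdist_le.
    by move=> u; rewrite /= !le_min => /andP[/andP[]].
  - by move=> w; exact: pair_bump01.
  - exact: pair_bump_center.
  move=> n w w0; have : 0 < pair_bump z r w.
    by have /andP[b0' _] := pair_bump01 z r w r0; rewrite lt0r w0.
  rewrite pair_bump_gt0 // => /andP[zw1 zw2].
  have := length_distances_lipschitz (d_ n) z w; rewrite ler_norml => /andP[_].
  have : alpha * (mdist z.1 w.1 + mdist z.2 w.2) <= e.
    rewrite (_ : e = alpha * (e / (2 * alpha) + e / (2 * alpha))); last first.
      by field; rewrite gt_eqF.
    apply: ler_wpM2l => //; apply: lerD; apply: ltW.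
      by apply: lt_le_trans zw1 _; rewrite ge_min lexx orbT.
    by apply: lt_le_trans zw2 _; rewrite ge_min lexx orbT.
  lra.
have : (((\val d z - e)%R)%:E < limn_einf (fun n => (\val (d_ n) z)%:E))%E.
  have -> : (fun n => (\val (d_ n) z)%:E) =
      (fun n => J_ z (d_ n) (\d_(z : borel_space z) : borel_measures R z)).
    by apply/funext => n; rewrite J_dirac.
  apply: (@lt_le_trans _ _ (J_ z d (\d_(z : borel_space z) : borel_measures R z))).
    by rewrite J_dirac lte_fin gtrBl.
  by apply: J_inf; exact: cvg_cst.
move=> /lt_limn_einf_near; apply: filterS => n; rewrite lte_fin; lra.
Qed.

End distances_and_measures.

(** * Nonexpansive functions *)

Lemma cvgr_sum {R : realType} {I : Type} (r : seq I) (f_ : nat -> I -> R) (l : I -> R) :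
  (forall i, f_ n i @[n --> \oo] --> l i) ->
  \sum_(i <- r) f_ n i @[n --> \oo] --> \sum_(i <- r) l i.
Proof.
by move=> fl; apply: (@cvg_big R) => [|i _]; [exact: add_continuous | exact: fl].
Qed.

Section functions_of_constant_one.
Context {R : realType} {E : Type}.

Lemma Lip_const_le1 (rho : E * E -> R) (u : E -> R) : is_distance rho ->
  (Lip_const rho u <= 1)%E <-> forall x y, `|u x - u y| <= rho (x, y).
Proof.
move=> [rho_ge0 rho0 _ _]; rewrite /Lip_const ge_max lee01 /=; split=> [sup1 x y|u1].
  have [->|xy] := pselect (x = y); first by rewrite subrr normr0.
  have rho_gt0 : 0 < rho (x, y).
    by rewrite lt_neqAle rho_ge0 andbT eq_sym; apply/eqP => /rho0.
  rewrite -[leRHS]mul1r -ler_pdivrMr // -lee_fin; apply: le_trans sup1.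
  by apply: ereal_sup_ubound; exists x, y.
apply: ge_ereal_sup => _ [x [y [xy ->]]].
have rho_gt0 : 0 < rho (x, y).
  by rewrite lt_neqAle rho_ge0 andbT eq_sym; apply/eqP => /rho0.
by rewrite lee_fin ler_pdivrMr // mul1r.
Qed.

Context {d_ : nat -> E * E -> R} {d : E * E -> R}.
Hypotheses (d_distance : forall n, is_distance (d_ n)) (d_lim : is_distance d).
Hypothesis d_cvg : forall z, d_ n z @[n --> \oo] --> d z.

(** McShane's formula over the countable set [q], with the corrections [c n i]:
    they tend to 0 for fixed [i], and make each term at least [u (q j) - c n j] at
    the point [q j], whichever of [i] and [j] is larger. *)
Lemma lipschitz1_recovery (q : nat -> E) (u : E -> R) :
  (forall x y, `|u x - u y| <= d (x, y)) ->
  exists u_ : nat -> E -> R, (forall n x y, `|u_ n x - u_ n y| <= d_ n (x, y)) /\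
    forall j, u_ n (q j) @[n --> \oo] --> u (q j).
Proof.
move=> u1.
have uB x y : u x - u y <= d (x, y) by rewrite (le_trans (ler_norm _)).
have dC x y : d (x, y) = d (y, x) by case: d_lim.
have dnC n x y : d_ n (x, y) = d_ n (y, x) by case: (d_distance n).
have dn_triangle n y x z : d_ n (x, z) <= d_ n (x, y) + d_ n (y, z).
  by case: (d_distance n).
pose c n i := \sum_(j < i.+1) `|d (q i, q j) - d_ n (q i, q j)|.
have c_ge n i j : (j <= i)%N -> d (q i, q j) - d_ n (q i, q j) <= c n i.
  rewrite -ltnS => ji; rewrite /c (bigD1 (Ordinal ji)) //=.
  by rewrite (le_trans (ler_norm _)) // lerDl sumr_ge0.
have c_ge0 n i : 0 <= c n i by rewrite sumr_ge0.
pose term n x i := u (q i) + d_ n (x, q i) + c n i.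
have term_ge n j i x : u (q j) - c n j - d_ n (x, q j) <= term n x i.
  rewrite /term.
  have := uB (q j) (q i); have := dn_triangle n x (q j) (q i); have := c_ge0 n j.
  have := c_ge0 n i; rewrite (dnC n (q j) x).
  have [/c_ge - /(_ n)|/ltnW/c_ge - /(_ n)] := leqP j i; last by lra.
  by rewrite (dC (q i)) (dnC n (q i)); lra.
pose u_ n x := inf (range (term n x)).
have u_le n x i : u_ n x <= term n x i.
  apply: ge_inf; last by exists i.
  by exists (u (q 0%N) - c n 0%N - d_ n (x, q 0%N)) => _ [k _ <-]; exact: term_ge.
have le_u n x r : (forall i, r <= term n x i) -> r <= u_ n x.
  move=> rle; apply: lb_le_inf; first by exists (term n x 0%N); exists 0%N.
  by move=> _ [i _ <-].
exists u_; split=> [n x y|j].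
  have H x' y' : u_ n x' - u_ n y' <= d_ n (x', y').
    rewrite lerBlDr addrC -lerBlDr; apply: le_u => i.
    have := u_le n x' i; have := dn_triangle n y' x' (q i); rewrite /term; lra.
  by rewrite ler_norml H andbT; have := H y x; rewrite (dnC n y); lra.
have c_lim : c n j @[n --> \oo] --> (0 : R).
  rewrite (_ : 0 = \sum_(k < j.+1) (0 : R)); last by rewrite big1.
  apply: cvgr_sum => k; apply/norm_cvg0P.
  rewrite -[X in _ --> X](subrr (d (q j, q k))).
  by apply: cvgB; [exact: cvg_cst | exact: d_cvg].
apply: (@squeeze_cvgr _ _ _ _ (fun n => u (q j) - c n j) (fun n => u (q j) + c n j)).
- apply: nearW => n; have dn0 : d_ n (q j, q j) = 0.
    by case: (d_distance n) => _ dn0 _ _; exact/dn0.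
  rewrite {1}/u_; apply/andP; split.
    by apply: le_u => i; have := term_ge n j i (q j); rewrite dn0 subr0.
  by have := u_le n (q j) j; rewrite /term dn0 addr0.
- by rewrite -[X in _ --> X]subr0; apply: cvgB => //; exact: cvg_cst.
- by rewrite -[X in _ --> X]addr0; apply: cvgD => //; exact: cvg_cst.
Qed.

End functions_of_constant_one.

(** Close points of the dense set control the values at any point, with an error
    that does not depend on [n]. *)
Lemma lipschitz_dense_cvg {R : realType} {E : metricType R} (a : R) (q : nat -> E)
    (f_ : nat -> E -> R) (f : E -> R) :
  (forall (x : E) (e : R), 0 < e -> exists n, mdist (q n) x < e) ->
  0 <= a -> (forall n x y, `|f_ n x - f_ n y| <= a * mdist x y) ->
  (forall x y, `|f x - f y| <= a * mdist x y) ->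
  (forall i, f_ n (q i) @[n --> \oo] --> f (q i)) ->
  (f_ n : {family compact, E -> R}) @[n --> \oo] --> (f : {family compact, E -> R}).
Proof.
move=> q_dense a0 f_a fa fq; have a1 : 0 < a + 1 by rewrite ltr_wpDl.
apply: equicontinuous_cvg_family_compact => x.
  move=> e e0; apply/nbhs_mdist; exists (e / (a + 1)) => [|y xy].
    exact: divr_gt0.
  suff axy : a * mdist x y <= e by split=> [|n]; apply: le_trans axy.
  have -> : e = (a + 1) * (e / (a + 1)) by field; rewrite gt_eqF.
  by apply: ler_pM; rewrite ?mdist_ge0 ?lerDl // ltW.
apply/cvgrPdist_le => e e0.
have e3 : 0 < e / 3 by rewrite divr_gt0.
have [i qi] := q_dense x (e / 3 / (a + 1)) (divr_gt0 e3 a1).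
have aq : a * mdist (q i) x <= e / 3.
  have -> : e / 3 = (a + 1) * (e / 3 / (a + 1)) by field; rewrite gt_eqF.
  by apply: ler_pM; rewrite ?mdist_ge0 ?lerDl // ltW.
have /cvgrPdist_le/(_ _ e3) := fq i; apply: filterS => n fn.
have := f_a n (q i) x; have := fa (q i) x; move: fn.
rewrite !ler_norml => /andP[? ?] /andP[? ?] /andP[? ?]; apply/andP; split; lra.
Qed.

Section nonexpansive_functions.
Context {R : realType} {X : metricType R}.
Hypothesis X_loc_compact : locally_compact [set: X].
Context {alpha : R} (alpha_gt1 : 1 < alpha) {Omega : set X} (Omega_open : open Omega).

Let alpha_gt0 : 0 < alpha.
Proof. exact: lt_trans ltr01 alpha_gt1. Qed.

Let alpha_ge0 : 0 <= alpha.
Proof. exact: ltW. Qed.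

Context (d_ : nat -> length_distances alpha Omega) (d : length_distances alpha Omega).

Local Notation nonexpansive d u := (forall x y, `|u x - u y| <= \val d (x, y)).

Lemma F_eq0 (d' : length_distances alpha Omega) (u : Lip_functions Omega) :
  nonexpansive d' (\val u) -> F_ d' u = 0%E.
Proof.
move=> u1; rewrite /F_; case: ifPn => // /negP[].
exact/Lip_const_le1/u1/length_distances_distance.
Qed.

Lemma F_lt1 (d' : length_distances alpha Omega) (u : Lip_functions Omega) :
  (F_ d' u < 1)%E -> nonexpansive d' (\val u).
Proof.
rewrite /F_; case: ifPn => // u1 _.
exact/(Lip_const_le1 _ _ (length_distances_distance d')).
Qed.

Lemma F_ge0 (d' : length_distances alpha Omega) (u : Lip_functions Omega) :
  (0 <= F_ d' u)%E.
Proof. by rewrite /F_; case: ifP. Qed.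

Lemma nonexpansive_ambient (d' : length_distances alpha Omega) (u : Omega -> R) :
  nonexpansive d' u -> forall x y, `|u x - u y| <= alpha * mdist x y.
Proof. by move=> u1 x y; apply: (le_trans (u1 x y)); exact: length_distances_le. Qed.

Lemma Lip_function_of (u : Omega -> R) :
  (forall x y, `|u x - u y| <= alpha * mdist x y) -> Lip_functions Omega u.
Proof. by move=> ua; exists alpha. Qed.

Lemma nonexpansive_distance (d' : length_distances alpha Omega) (x : Omega) :
  nonexpansive d' (fun y => \val d' (x, y)).
Proof.
have [_ _ dC d_triangle] := length_distances_distance d'.
move=> y z; rewrite ler_norml; have := d_triangle x y z; have := d_triangle x z y.
by rewrite (dC z y) => ? ?; apply/andP; split; lra.
Qed.

(** If [u] is not nonexpansive for [d], some pair [x], [y] witnesses it, and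
    then also for [d_ n] and functions close to [u]. *)
Lemma F_Gamma_cvg : pointwise_cvg d_ d ->
  Gamma_cvg (fun n => F_ (d_ n)) (F_ d).
Proof.
move=> pw u; split=> [u_ /cvg_set_type uu|].
  have [/F_eq0 ->|nu] := pselect (nonexpansive d (\val u)).
    by apply: le_limn_einf; apply: nearW => n; exact: F_ge0.
  have [x [y uxy]] : exists x y, \val d (x, y) < `|\val u x - \val u y|.
    apply: contrapT => noxy; apply: nu => x y; rewrite leNgt; apply/negP => uxy.
    by apply: noxy; exists x, y.
  have upt := cvg_family_compact_pointwise _ _ uu.
  apply: (@le_trans _ _ +oo%E); first exact: leey.
  apply: le_limn_einf.
  have gap_lim : `|\val (u_ n) x - \val (u_ n) y| - \val (d_ n) (x, y) @[n --> \oo] -->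
      `|\val u x - \val u y| - \val d (x, y).
    by apply: cvgB; [apply: cvg_norm; apply: cvgB; exact: upt | exact: pw].
  have : \forall n \near \oo, 0 < `|\val (u_ n) x - \val (u_ n) y| - \val (d_ n) (x, y).
    by apply: (cvgr_gt _ gap_lim); rewrite subr_gt0.
  apply: filterS => n; rewrite subr_gt0 => un.
  rewrite /F_; case: ifPn => // /(Lip_const_le1 _ _ (length_distances_distance _)).
  by move=> /(_ x y); rewrite leNgt un.
have [u1|nu] := pselect (nonexpansive d (\val u)); last first.
  exists (fun=> u); first exact: cvg_cst.
  rewrite /F_; case: ifPn => [/(Lip_const_le1 _ _ (length_distances_distance _))//|_].
  exact: leey.
have [[x0 _]|noO] := pselect (exists x : Omega, True); last first.
  exists (fun=> u); first exact: cvg_cst.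
  apply: limn_esup_le; apply: nearW => n; rewrite !F_eq0 // => x.
  by exfalso; apply: noO; exists x.
have [q q_dense] := Omega_separable X_loc_compact alpha_gt1 Omega_open d x0.
have [u_ [u_1 u_q]] := lipschitz1_recovery
  (fun n => length_distances_distance (d_ n)) (length_distances_distance d) pw q _ u1.
exists (fun n => SigSub (mem_set (Lip_function_of _ (nonexpansive_ambient (d_ n) _ (u_1 n))))).
  apply/cvg_set_type; apply: (lipschitz_dense_cvg alpha q u_) => //.
    by move=> n; exact: nonexpansive_ambient (u_1 n).
  exact: nonexpansive_ambient u1.
apply: limn_esup_le; apply: nearW => n; rewrite !F_eq0 //; exact: u_1.
Qed.

(** The lower bound tests a recovery sequence of the nonexpansive function [d
    (x, _)] at [y]. The upper bound follows from the liminf inequality for the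
    functions [d_ n (x, _)], by compactness. *)
Lemma pointwise_cvg_of_F :
  Gamma_cvg (fun n => F_ (d_ n)) (F_ d) -> pointwise_cvg d_ d.
Proof.
move=> GF; apply/pointwise_cvgP => x y e e0; split; last first.
  pose u : Lip_functions Omega := SigSub (mem_set (Lip_function_of _
    (nonexpansive_ambient d _ (nonexpansive_distance d x)))).
  have [_ [u_ /cvg_set_type uu]] := GF u.
  rewrite (F_eq0 d u (nonexpansive_distance d x)) => F_sup.
  have upt := cvg_family_compact_pointwise _ _ uu.
  have u_lim : \val (u_ n) y - \val (u_ n) x @[n --> \oo] -->
      \val d (x, y) - \val d (x, x).
    by apply: cvgB; [exact: (upt y) | exact: (upt x)].
  have /cvgrPdist_le/(_ e e0) := u_lim.
  have /limn_esup_lt_near : (limn_esup (fun n => F_ (d_ n) (u_ n)) < 1)%E.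
    by apply: le_lt_trans F_sup _; rewrite lte_fin.
  apply: filterS2 => n /F_lt1/(_ y x).
  have [_ _ dnC _] := length_distances_distance (d_ n).
  have [_ /(_ x x)[_ /(_ erefl) dxx] _ _] := length_distances_distance d.
  by rewrite dxx subr0 (dnC y) !ler_norml => /andP[? ?] /andP[? ?]; lra.
(* Otherwise a limit of the functions [d_ n (x, _)] along these n violates the
   lower bound; off a suitable set of indices they are replaced by the limit. *)
apply: contrapT => /not_near_frequently; set B := (fun n => ~ _) => freqB.
have [U [ultraU ooU UB]] := frequent_ultrafilter B freqB.
pose v_ n z : R := \val (d_ n) (x, z).
have v_bound n z : 0 <= v_ n z <= alpha * mdist x z.
  by rewrite length_distances_ge0 //= length_distances_le.
have lim_v z : exists r : R, v_ n z @[n --> U] --> r.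
  have [|r [_ /= clr]] := @segment_compact R 0 (alpha * mdist x z) (v_^~ z @ U)
      (fmap_proper_filter _ _).
    by apply: (@filterS _ U _ setT) => [n _|]; [rewrite /= in_itv /= v_bound | exact: filterT].
  exists r => P Pr; have [//|nUP] := in_ultra_setVsetC (v_^~ z @^-1` P) ultraU.
  by have [w [/= nPw /nPw]] := clr (~` P) P nUP Pr.
have [v vP] := choice lim_v.
have near_v z r : 0 < r -> U [set n | `|v z - v_ n z| < r].
  by move=> r0; have /cvgrPdist_lt/(_ r r0) := vP z.
have v_lip n := nonexpansive_ambient (d_ n) (v_ n) (nonexpansive_distance (d_ n) x).
have v_ambient z w : `|v z - v w| <= alpha * mdist z w.
  apply/ler_addgt0Pr => r r0; have r2 : 0 < r / 2 by rewrite divr_gt0.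
  have [n [/= hz hw]] := filter_ex (filterI (near_v z _ r2) (near_v w _ r2)).
  have := v_lip n z w; move: hz hw.
  by rewrite !ltr_norml !ler_norml => /andP[? ?] /andP[? ?] /andP[? ?]; apply/andP; split; lra.
have [q q_dense] := Omega_separable X_loc_compact alpha_gt1 Omega_open d x.
(* Only finitely many points at a time: U is closed under finite intersections. *)
pose P k := [set n | B n /\ forall i : 'I_k, `|v (q i) - v_ n (q i)| < k.+1%:R^-1].
have UP k : U (P k).
  apply: filterI => //; apply: (@filter_forall _ _ (fun i n => _) U _) => i.
  by apply: near_v; rewrite invr_gt0.
have [S [freqS S_P]] := pseudo_intersection U P _ ooU UP.
pose w_ n : Omega -> R := if pselect (S n) then v_ n else v.
have w_ambient n z z' : `|w_ n z - w_ n z'| <= alpha * mdist z z'.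
  by rewrite /w_; case: pselect => ?; [exact: v_lip | exact: v_ambient].
pose V : Lip_functions Omega := SigSub (mem_set (Lip_function_of v v_ambient)).
pose W n : Lip_functions Omega := SigSub (mem_set (Lip_function_of (w_ n) (w_ambient n))).
have W_V : W n @[n --> \oo] --> V.
  apply/cvg_set_type; apply: (lipschitz_dense_cvg alpha q w_) => // i.
  apply/cvgrPdist_lt => r r0.
  have [k [/= ik kr]] := filter_ex (filterI (nbhs_infty_gt i)
    (near_infty_natSinv_lt (PosNum r0))).
  apply: filterS (S_P k) => n SP; rewrite /w_; case: pselect => Sn.
    have [_ /(_ (Ordinal ik)) vn] := SP Sn; exact: lt_trans kr.
  by rewrite subrr normr0.
have v1 : nonexpansive d v.
  apply: (F_lt1 d V); apply: le_lt_trans ((GF V).1 W W_V) _.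
  apply: (@le_lt_trans _ _ 0%E); last by rewrite lte_fin.
  apply: limn_einf_le_frequently => N; have [n Nn Sn] := freqS N.
  exists n => //; rewrite F_eq0 // /W /= /w_; case: pselect => // ?.
  exact: nonexpansive_distance.
have vx : v x = 0.
  apply/eqP; rewrite -normr_le0; apply/ler_addgt0Pl => r r0.
  have [n /= /ltW] := filter_ex (near_v x _ r0).
  by rewrite /v_; have [_ /(_ x x)[_ ->]] := length_distances_distance (d_ n); rewrite // subr0 addr0.
have vy : \val d (x, y) + e <= v y.
  apply/ler_addgt0Pr => r r0.
  have [n [hy Bn]] := filter_ex (filterI (near_v y _ r0) UB).
  have {hy} : `|v y - v_ n y| < r by [].
  have /negP : ~ (\val (d_ n) (x, y) <= \val d (x, y) + e) by [].
  by rewrite -ltNge /v_ ltr_norml => ? /andP[? ?]; lra.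
have := v1 x y; rewrite vx sub0r normrN => /(le_trans (ler_norm _)); lra.
Qed.

End nonexpansive_functions.

(** * Lengths of curves in the closure *)

Section lengths_in_the_closure.
Context {R : realType} {X : metricType R}.
Context {alpha : R} (alpha_gt1 : 1 < alpha) {Omega : set X}.

Let alpha_gt0 : 0 < alpha.
Proof. exact: lt_trans ltr01 alpha_gt1. Qed.

Let alpha_ge0 : 0 <= alpha.
Proof. exact: ltW. Qed.

Local Notation closure_dist d := (closure_extension (\val d)).

Lemma closure_dist_to_closure (d : length_distances alpha Omega) x y :
  closure_dist d (to_closure x, to_closure y) = \val d (x, y).
Proof.
by have [+ _] := closure_extensionP alpha_ge0 (length_distances_distance d)
  (length_distances_le d); exact.
Qed.

Lemma closure_dist_lipschitz (d : length_distances alpha Omega) :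
  pair_lipschitz alpha (closure_dist d).
Proof.
by have [_] := closure_extensionP alpha_ge0 (length_distances_distance d)
  (length_distances_le d).
Qed.

Lemma curve_length_to_closure (d : length_distances alpha Omega)
    (gamma : `[0 : R, 1]%classic -> Omega) :
  curve_length (closure_dist d) (fun t => to_closure (gamma t)) =
  curve_length (\val d) gamma.
Proof.
congr ereal_sup; apply/seteqP; split=> _ [k [t [tP ->]]]; exists k, t; split=> //;
  by congr EFin; apply: eq_bigr => i _; rewrite closure_dist_to_closure.
Qed.

Lemma Lip_curve_of (gamma : `[0 : R, 1]%classic -> closure Omega) K :
  (forall s t, mdist (gamma s) (gamma t) <= K * `|\val s - \val t|) ->
  Lip_curves Omega gamma.
Proof. by move=> gammaK; exists K. Qed.

Lemma Lip_curves_cvgP (gamma_ : nat -> Lip_curves Omega) (gamma : Lip_curves Omega) :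
  gamma_ n @[n --> \oo] --> gamma <->
  forall e : R, 0 < e -> \forall n \near \oo, forall t,
    mdist (\val gamma t) (\val (gamma_ n) t) < e.
Proof.
rewrite cvg_set_type cvg_uniformP; split=> gg e /gg; apply: filterS => n gn t.
  by have := gn t; rewrite ballEmdist.
by rewrite ballEmdist; exact: gn.
Qed.

Context (d_ : nat -> length_distances alpha Omega) (d : length_distances alpha Omega).

Lemma closure_dist_cvg (z_ : nat -> closure Omega * closure Omega) z :
  pointwise_cvg d_ d ->
  (forall e, 0 < e -> \forall n \near \oo, mdist z.1 (z_ n).1 + mdist z.2 (z_ n).2 <= e) ->
  closure_dist (d_ n) (z_ n) @[n --> \oo] --> closure_dist d z.
Proof.
move=> pw zz; apply/cvgrPdist_le => e e0.
pose r := e / 8 / alpha.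
have r0 : 0 < r by rewrite !divr_gt0.
have ar : alpha * r = e / 8 by rewrite /r mulrC divfK // gt_eqF.
have arr : alpha * (r + r) = e / 4 by rewrite mulrDr ar; lra.
have [p zp] := closure_approx z.1 r r0.
have [q zq] := closure_approx z.2 r r0.
have e4 : 0 < e / 4 by rewrite divr_gt0.
have /cvgrPdist_le/(_ _ e4) pqn := pw (p, q).
apply: filterS2 pqn (zz _ r0) => n pqn zn.
have a1 : `|closure_dist d z - \val d (p, q)| <= e / 4.
  rewrite -closure_dist_to_closure; apply: (le_trans (closure_dist_lipschitz d _ _)) => /=.
  by rewrite -arr; apply: ler_wpM2l => //; apply: lerD; exact: ltW.
have a2 : `|closure_dist (d_ n) z - \val (d_ n) (p, q)| <= e / 4.
  rewrite -closure_dist_to_closure; apply: (le_trans (closure_dist_lipschitz _ _ _)) => /=.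
  by rewrite -arr; apply: ler_wpM2l => //; apply: lerD; exact: ltW.
have a3 : `|closure_dist (d_ n) z - closure_dist (d_ n) (z_ n)| <= e / 8.
  by rewrite -ar; apply: (le_trans (closure_dist_lipschitz _ _ _)); exact: ler_wpM2l.
have e_split : e = e / 4 + (e / 4 + (e / 4 + (e / 8 + e / 8))) by lra.
rewrite e_split; apply: (le_trans (ler_distD (\val d (p, q)) _ _)); apply: lerD => //.
apply: (le_trans (ler_distD (\val (d_ n) (p, q)) _ _)); apply: lerD => //.
apply: (le_trans (ler_distD (closure_dist (d_ n) z) _ _)); apply: lerD.
  by rewrite distrC.
by apply: (le_trans a3); rewrite lerDl divr_ge0 // ltW.
Qed.

(** For each partition the sum for [gamma] is the limit of the sums for the
    [gamma_ n], since the extended distances are equi-Lipschitz. *)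
Lemma L_Gamma_liminf (gamma : Lip_curves Omega) (gamma_ : nat -> Lip_curves Omega) :
  pointwise_cvg d_ d -> gamma_ n @[n --> \oo] --> gamma ->
  (L_ d gamma <= limn_einf (fun n => L_ (d_ n) (gamma_ n)))%E.
Proof.
move=> pw /Lip_curves_cvgP gg; apply: ge_ereal_sup => _ [k [t [tP ->]]].
have sum_lim : \sum_(1 <= i < k.+1) closure_dist (d_ n)
      (\val (gamma_ n) (t i), \val (gamma_ n) (t i.-1)) @[n --> \oo] -->
    \sum_(1 <= i < k.+1) closure_dist d (\val gamma (t i), \val gamma (t i.-1)).
  apply: cvgr_sum => i; apply: closure_dist_cvg => // e e0.
  have e2 : 0 < e / 2 by rewrite divr_gt0.
  apply: filterS (gg _ e2) => n gn.
  by rewrite (splitr e); apply: lerD; apply: ltW; exact: gn.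
apply/lee_addgt0Pr => e e0; rewrite -leeBlDr // -EFinB; apply: le_limn_einf.
have /cvgrPdist_le/(_ e e0) := sum_lim; apply: filterS => n sn.
apply: le_trans (sum_le_curve_length _ _ _ tP); rewrite lee_fin lerBlDr.
exact: ler_distlDr.
Qed.

(** The polygon through points of [Omega] close to the [gamma (i / k)], with
    near-geodesics of [d_ n] as edges, is close to [gamma] since its edges are
    short, and its length is close to a sum of distances of [d]. *)
Lemma near_recovery (gamma : Lip_curves Omega) (l : R) : pointwise_cvg d_ d ->
  L_ d gamma = l%:E -> forall e, 0 < e -> \forall n \near \oo,
  exists g : Lip_curves Omega, (forall t, mdist (\val gamma t) (\val g t) <= e) /\
    (L_ (d_ n) g <= (l + e)%:E)%E.
Proof.
move=> pw gamma_l e e0.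
have [K K0 gammaK] : exists2 K, 0 <= K & forall s t,
    mdist (\val gamma s) (\val gamma t) <= K * `|\val s - \val t|.
  have [K gammaK] := set_valP gamma; exists `|K| => // s t.
  apply: (le_trans (gammaK s t)).
  by apply: ler_wpM2r; [exact: normr_ge0 | exact: ler_norm].
(* C collects the constants of the bounds on the distance and on the length; k is
   the number of edges, and dl the precision at each vertex. *)
pose C := 3 * alpha * alpha + 3 * alpha + 2.
have C0 : 0 < C by rewrite /C; nra.
pose h := e / C; have h0 : 0 < h by rewrite divr_gt0.
have Ch : C * h = e by rewrite /h mulrC divfK // gt_eqF.
have [k k0 Kk] : exists2 k : nat, (0 < k)%N & K / k%:R <= h.
  have [k [/= k0 kh]] := filter_ex (filterI (nbhs_infty_gt 0%N)
    (nbhs_infty_gtr (K / h))).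
  exists k => //; rewrite ler_pdivrMr ?ltr0n //.
  by rewrite mulrC -ler_pdivrMr // ltW.
have kR : 0 < k%:R :> R by rewrite ltr0n.
have k1 : 1 <= k%:R :> R by rewrite ler1n.
pose dl := h / k%:R; have dl0 : 0 < dl by rewrite divr_gt0.
have kdl : k%:R * dl = h by rewrite /dl mulrC divfK // gt_eqF.
have dlh : dl <= h by rewrite /dl ler_pdivrMr // ler_peMr // ltW.
have node i : (i <= k)%N -> \val (unit_point (i%:R / k%:R : R)) = i%:R / k%:R.
  move=> ik; rewrite val_unit_point // divr_ge0 //= ler_pdivrMr // mul1r ler_nat //.
have /choice[p pP] : forall i : nat, exists p : Omega,
    mdist (\val gamma (unit_point (i%:R / k%:R))) (to_closure p) < dl.
  by move=> i; exact: closure_approx.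
have near_p : \forall n \near \oo, forall i : 'I_k,
    \val (d_ n) (p i, p i.+1) <= \val d (p i, p i.+1) + dl.
  apply: (@filter_forall _ _ (fun i n => _) \oo _) => i.
  have /pointwise_cvgP H := pw.
  by have [] := H (p i) (p i.+1) dl dl0.
apply: filterS near_p => n near_p.
have p_close i : (i < k)%N -> mdist (p i) (p i.+1) <= 3 * h.
  move=> ik.
  have step : mdist (\val gamma (unit_point (i%:R / k%:R)))
      (\val gamma (unit_point (i.+1%:R / k%:R))) <= h.
    apply: (le_trans (gammaK _ _)).
    rewrite !node // ?(ltnW ik) // -mulrBl -natr1 opprD addrA subrr add0r.
    by rewrite mulN1r normrN ger0_norm ?invr_ge0.
  have -> : 3 * h = h + (h + h) by ring.
  rewrite -[mdist (p i) (p i.+1)]/(mdist (to_closure (p i)) (to_closure (p i.+1))).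
  apply: (le_trans (metric_triangle _ (\val gamma (unit_point (i%:R / k%:R))) _)).
  apply: lerD; first by rewrite metric_sym; exact/ltW/(lt_le_trans (pP i)).
  apply: (le_trans (metric_triangle _ (\val gamma (unit_point (i.+1%:R / k%:R))) _)).
  by apply: lerD => //; exact/ltW/(lt_le_trans (pP i.+1)).
pose M := (3 * alpha + 1) * h.
have pM i : (i < k)%N -> \val (d_ n) (p i, p i.+1) + dl <= M.
  move=> ik; have -> : M = alpha * (3 * h) + h by rewrite /M; ring.
  apply: lerD => //; apply: (le_trans (length_distances_le _ _)).
  by apply: ler_wpM2l => //; exact: p_close.
have [g [g_len g_lip g_near]] := near_geodesic_polygon_unit
  (length_distances_distance (d_ n)) (length_distances_length_space (d_ n))
  p k dl M k0 dl0 pM.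
have g_ambient s t : mdist (to_closure (g s)) (to_closure (g t)) <=
    alpha * (M * k%:R) * `|\val s - \val t|.
  apply: (le_trans (mdist_le_length_distances alpha_gt1 (d_ n) (g s) (g t))).
  by rewrite -mulrA; apply: ler_wpM2l.
exists (SigSub (mem_set (Lip_curve_of (fun t => to_closure (g t)) _ g_ambient))); split.
  move=> t /=; have /andP[t0 t1] := unit_point_itv t.
  pose i := Num.truncn (k%:R * \val t).
  have /andP[it ti] : i%:R <= k%:R * \val t < i.+1%:R.
    by apply: truncn_itv; rewrite mulr_ge0.
  have ik : (i <= k)%N.
    rewrite -(ler_nat R); apply: (le_trans it); rewrite -[leRHS]mulr1.
    exact: ler_wpM2l.
  have := g_near i t ik; rewrite it ltW // => /(_ isT) pg.
  have ti_dist : `|\val t - i%:R / k%:R| <= k%:R^-1.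
    rewrite ger0_norm; last by rewrite subr_ge0 ler_pdivrMr // mulrC.
    rewrite -(ler_pM2l kR) mulrBr divff ?gt_eqF // [k%:R * (_ / _)]mulrC divfK ?gt_eqF //.
    by rewrite lerBlDl natr1 ltW.
  have s1 : mdist (\val gamma t) (\val gamma (unit_point (i%:R / k%:R))) <= h.
    apply: (le_trans (gammaK _ _)); rewrite node //.
    by apply: le_trans Kk; exact: ler_wpM2l.
  have s3 : mdist (to_closure (p i)) (to_closure (g t)) <= alpha * M.
    apply: (le_trans (mdist_le_length_distances alpha_gt1 (d_ n) (p i) (g t))).
    exact: ler_wpM2l.
  have -> : e = h + (h + alpha * M) + 2 * (alpha * h) by rewrite -Ch /C /M; ring.
  apply: (@le_trans _ _ (h + (h + alpha * M))); last first.
    by rewrite lerDl; apply: mulr_ge0 => //; apply: mulr_ge0 => //; exact: ltW.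
  apply: (le_trans (metric_triangle _ (\val gamma (unit_point (i%:R / k%:R))) _)).
  apply: lerD => //; apply: (le_trans (metric_triangle _ (to_closure (p i)) _)).
  apply: lerD => //; exact/ltW/(lt_le_trans (pP i)).
rewrite /L_ /= curve_length_to_closure; apply: (le_trans g_len); rewrite lee_fin.
have sum_l : \sum_(i < k) closure_dist d
    (\val gamma (unit_point (i.+1%:R / k%:R)), \val gamma (unit_point (i%:R / k%:R))) <= l.
  rewrite -lee_fin -gamma_l.
  have tP : partition_points k (fun i => unit_point (i%:R / k%:R) : `[0 : R, 1]%classic).
    split; [by rewrite node // mul0r|by rewrite node // divff // gt_eqF|].
    move=> i ik; rewrite !node ?(ltnW ik) // ltr_pM2r ?invr_gt0 // ltr_nat //.
  have := sum_le_curve_length (rho := closure_dist d) (\val gamma) k _ tP.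
  by rewrite big_add1 /= big_mkord.
have edge (i : 'I_k) : \val (d_ n) (p i, p i.+1) + dl <= closure_dist d
    (\val gamma (unit_point (i.+1%:R / k%:R)), \val gamma (unit_point (i%:R / k%:R))) +
    (2 * alpha + 2) * dl.
  have d_near : `|closure_dist d (\val gamma (unit_point (i.+1%:R / k%:R)),
      \val gamma (unit_point (i%:R / k%:R))) - \val d (p i.+1, p i)| <= alpha * (dl + dl).
    rewrite -closure_dist_to_closure; apply: (le_trans (closure_dist_lipschitz d _ _)).
    by apply: ler_wpM2l => //; apply: lerD; apply: ltW; exact: pP.
  have -> : (2 * alpha + 2) * dl = alpha * (dl + dl) + dl + dl by ring.
  rewrite !addrA lerD2r; apply: (le_trans (near_p i)); rewrite lerD2r.
  have [_ _ -> _] := length_distances_distance d.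
  exact: ler_distlCDr.
apply: (le_trans (ler_sum _ (fun i _ => edge i))).
have sum_dl : \sum_(i < k) (2 * alpha + 2) * dl = (2 * alpha + 2) * h.
  by rewrite sumr_const card_ord -[LHS]mulr_natr -mulrA [dl * _]mulrC kdl.
rewrite big_split sum_dl.
apply: lerD => //; rewrite -[leRHS]Ch; apply: ler_wpM2r; first exact: ltW.
have : 0 <= alpha * alpha by exact: mulr_ge0.
by have := alpha_ge0; rewrite /C -mulrA; lra.
Qed.

(** The curves of [near_recovery] for a precision tending to 0 form a recovery
    sequence. *)
Lemma L_Gamma_cvg : pointwise_cvg d_ d ->
  Gamma_cvg (fun n => L_ (d_ n)) (L_ d).
Proof.
move=> pw gamma; split=> [gamma_ |]; first exact: L_Gamma_liminf.
have [|] := ltP (L_ d gamma) +oo%E; last first.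
  by rewrite leye_eq => /eqP ->; exists (fun=> gamma); [exact: cvg_cst | exact: leey].
move=> L_fin.
have L_gtNy : (-oo < L_ d gamma)%E.
  exact: lt_le_trans (ltNyr _) (endpoints_le_curve_length (\val gamma)).
have gamma_l : L_ d gamma = (fine (L_ d gamma))%:E by rewrite fineK // fin_real // L_gtNy.
set l := fine _ in gamma_l.
have r_gt0 k : 0 < k.+1%:R^-1 :> R by rewrite invr_gt0.
have [g g_good] := diagonal_sequence gamma (fun k n (g : Lip_curves Omega) =>
  (forall t, mdist (\val gamma t) (\val g t) <= k.+1%:R^-1) /\
  (L_ (d_ n) g <= (l + k.+1%:R^-1)%:E)%E) (fun k => near_recovery gamma l pw gamma_l _ (r_gt0 k)).
have g_near (e : R) : 0 < e -> \forall n \near \oo,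
    (forall t, mdist (\val gamma t) (\val (g n) t) < e) /\ (L_ (d_ n) (g n) <= (l + e)%:E)%E.
  move=> e0; have [k /= ke] := filter_ex (near_infty_natSinv_lt (PosNum e0)).
  apply: filterS (g_good k) => n [j kj [g_dist g_len]].
  have je : j.+1%:R^-1 < e by apply: le_lt_trans ke; rewrite lef_pV2 ?posrE // ler_nat.
  split=> [t|]; first exact: le_lt_trans (g_dist t) je.
  by apply: le_trans g_len _; rewrite lee_fin lerD2l ltW.
exists g; first by apply/Lip_curves_cvgP => e /g_near; apply: filterS => n [].
rewrite gamma_l; apply/lee_addgt0Pr => e e0; apply: limn_esup_le.
by apply: filterS (g_near e e0) => n [].
Qed.

End lengths_in_the_closure.

Section distances_from_lengths.
Context {R : realType} {X : metricType R}.
Hypotheses (X_loc_compact : locally_compact [set: X]) (X_complete : complete_space X).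
Context {alpha : R} (alpha_gt1 : 1 < alpha) {Omega : set X}.

Let alpha_gt0 : 0 < alpha.
Proof. exact: lt_trans ltr01 alpha_gt1. Qed.

Let alpha_ge0 : 0 <= alpha.
Proof. exact: ltW. Qed.

Local Notation closure_dist d := (closure_extension (\val d)).

Context (d_ : nat -> length_distances alpha Omega) (d : length_distances alpha Omega).

(** The upper bound follows from a recovery sequence of a near-geodesic of [d]:
    its curves almost join [x] to [y]. The lower bound follows from the liminf
    inequality for near-geodesics of the [d_ n], by compactness. *)
Lemma pointwise_cvg_of_L :
  Gamma_cvg (fun n => L_ (d_ n)) (L_ d) -> pointwise_cvg d_ d.
Proof.
move=> GL; apply/pointwise_cvgP => x y e e0; split.
  have e4 : 0 < e / 4 by rewrite divr_gt0.
  have [c [c0 c1 cd cM]] := near_geodesic_ambient alpha_gt1 d x y _ e4.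
  pose gamma : Lip_curves Omega := SigSub (mem_set (Lip_curve_of
    (fun t => to_closure (c (\val t))) _ (fun s t => cM (\val s) (\val t)))).
  have gammaE t : \val gamma t = to_closure (c (\val t)) by [].
  have g0 : \val gamma (unit_point 0) = to_closure x.
    by rewrite gammaE val_unit_point ?lexx ?ler01 // c0.
  have g1 : \val gamma (unit_point 1) = to_closure y.
    by rewrite gammaE val_unit_point ?lexx ?ler01 // c1.
  have L_gamma : (L_ d gamma <= (\val d (x, y) + e / 4)%:E)%E.
    rewrite /L_ /= (curve_length_to_closure alpha_gt1 d (fun t => c (\val t))).
    have := curve_length_le (length_distances_distance d) (fun t => c (\val t))
      (fun t => (\val d (x, y) + e / 4) * t).
    rewrite mulr1 mulr0 subr0; apply=> s t st; rewrite -mulrBr.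
    by apply: (le_trans (cd _ _)); rewrite distrC ger0_norm // subr_ge0.
  have [_ [gamma_ /Lip_curves_cvgP gg L_sup]] := GL gamma.
  have r0 : 0 < e / 4 / alpha by rewrite divr_gt0.
  have /limn_esup_lt_near : (limn_esup (fun n => L_ (d_ n) (gamma_ n)) <
      (\val d (x, y) + e / 2)%:E)%E.
    apply: le_lt_trans (le_trans L_sup L_gamma) _; rewrite lte_fin; lra.
  apply: filterS2 (gg _ r0) => n gn Ln.
  have gx : mdist (to_closure x) (\val (gamma_ n) (unit_point 0)) <= e / 4 / alpha.
    by rewrite -g0; exact/ltW/gn.
  have gy : mdist (to_closure y) (\val (gamma_ n) (unit_point 1)) <= e / 4 / alpha.
    by rewrite -g1; exact/ltW/gn.
  have := le_lt_trans (endpoints_le_curve_length (rho := closure_dist (d_ n)) _) Ln.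
  rewrite lte_fin => cdn.
  have d_near : `|closure_dist (d_ n) (\val (gamma_ n) (unit_point 1),
      \val (gamma_ n) (unit_point 0)) - \val (d_ n) (y, x)| <= e / 2.
    rewrite -(closure_dist_to_closure alpha_gt1) distrC.
    apply: (le_trans (closure_dist_lipschitz alpha_gt1 (d_ n) _ _)).
    have -> : e / 2 = alpha * (e / 4 / alpha + e / 4 / alpha) by field; rewrite gt_eqF.
    by apply: ler_wpM2l => //; apply: lerD.
  have [_ _ -> _] := length_distances_distance (d_ n).
  apply: (le_trans (ler_distlCDr d_near)).
  by rewrite [in leRHS](splitr e) addrA; apply: lerD => //; exact: ltW.
(* Otherwise near-geodesics of the [d_ n] for these n would have a limit curve
   in the closure that is too short for [d]. *)
apply: contrapT => /not_near_frequently; set B := (fun n => ~ _) => freqB.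
have [U [ultraU ooU UB]] := frequent_ultrafilter B freqB.
have e2 : 0 < e / 2 by rewrite divr_gt0.
have /choice[c cP] := fun n => near_geodesic_ambient alpha_gt1 (d_ n) x y _ e2.
pose M := alpha * (alpha * mdist x y + e / 2).
have cM n s t : mdist (c n s) (c n t) <= M * `|s - t|.
  have [_ _ _ /(_ s t)/le_trans] := cP n; apply; apply: ler_wpM2r => //.
  apply: ler_wpM2l => //; apply: lerD => //; exact: (length_distances_le (d_ n) (x, y)).
have [gamma0 gamma0P] := ultrafilter_limit_of_curves U (fun n t => \val (c n t)) (\val x) M
  X_loc_compact X_complete ultraU (fun n s t => cM n s t)
  (fun n => let: And4 cn0 _ _ _ := cP n in congr1 _ cn0).
have near_gamma0 t (r : R) : 0 < r -> U [set n | mdist (gamma0 t) (\val (c n t)) < r].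
  by move=> r0; apply: (gamma0P t [set z | mdist (gamma0 t) z < r]); apply/nbhs_mdist; exists r.
have gamma0_cl t : closure Omega (gamma0 t).
  move=> P /nbhs_mdist[r r0 rP].
  have [n /= cn] := filter_ex (near_gamma0 t _ r0).
  by exists (\val (c n t)); split; [exact: set_valP | exact: rP].
have gamma0M s t : mdist (gamma0 s) (gamma0 t) <= M * `|s - t|.
  apply/ler_addgt0Pr => r r0; have r2 : 0 < r / 2 by rewrite divr_gt0.
  have [n [/= cs ct]] := filter_ex (filterI (near_gamma0 s _ r2) (near_gamma0 t _ r2)).
  have -> : M * `|s - t| + r = r / 2 + (M * `|s - t| + r / 2) by field.
  apply: (le_trans (metric_triangle _ (\val (c n s)) _)); apply: lerD; first exact: ltW.
  apply: (le_trans (metric_triangle _ (\val (c n t)) _)); apply: lerD; first exact: cM.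
  by rewrite metric_sym; exact: ltW.
pose gamma1 (t : `[0 : R, 1]%classic) : closure Omega := SigSub (mem_set (gamma0_cl (\val t))).
pose gamma : Lip_curves Omega := SigSub (mem_set (Lip_curve_of gamma1 M
  (fun s t => gamma0M (\val s) (\val t)))).
pose g n : Lip_curves Omega := SigSub (mem_set (Lip_curve_of
  (fun t => to_closure (c n (\val t))) M (fun s t => cM n (\val s) (\val t)))).
pose P k := [set n | B n /\ forall t, `[0 : R, 1]%classic t ->
  mdist (gamma0 t) (\val (c n t)) < k.+1%:R^-1].
(* Closeness at each time is uniform, as the curves are equi-Lipschitz and the
   interval is compact. *)
have UP k : U (P k).
  apply: filterI => //.
  have r0 : 0 < k.+1%:R^-1 / 3 :> R by rewrite divr_gt0 // invr_gt0.
  have /compact_near_coveringP cov := @segment_compact R 0 1.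
  apply: (cov _ U (fun n t => mdist (gamma0 t) (\val (c n t)) < k.+1%:R^-1)) => t _.
  have M1 : 0 < `|M| + 1 by rewrite ltr_wpDl.
  exists ([set s | `|t - s| < k.+1%:R^-1 / 3 / (`|M| + 1)],
          [set n | mdist (gamma0 t) (\val (c n t)) < k.+1%:R^-1 / 3]) => /=.
    split; last exact: near_gamma0.
    by apply/nbhs_ballP; exists (k.+1%:R^-1 / 3 / (`|M| + 1)) => //; exact: divr_gt0.
  move=> [s n] /= [ts ct].
  have Mts : M * `|t - s| < k.+1%:R^-1 / 3.
    apply: le_lt_trans (_ : `|t - s| * (`|M| + 1) < _); last by rewrite -ltr_pdivlMr.
    by rewrite mulrC; apply: ler_wpM2l => //; rewrite (le_trans (ler_norm _)) // lerDl.
  have -> : k.+1%:R^-1 = k.+1%:R^-1 / 3 + (k.+1%:R^-1 / 3 + k.+1%:R^-1 / 3) :> R.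
    by move: k.+1%:R^-1 => r; field.
  apply: (le_lt_trans (metric_triangle _ (gamma0 t) _)); apply: ltrD.
    by apply: le_lt_trans Mts; rewrite distrC.
  apply: (le_lt_trans (metric_triangle _ (\val (c n t)) _)); apply: ltrD => //.
  by apply: le_lt_trans Mts; exact: cM.
have [S [freqS S_P]] := pseudo_intersection U P _ ooU UP.
pose w n : Lip_curves Omega := if pselect (S n) then g n else gamma.
have w_gamma : w n @[n --> \oo] --> gamma.
  apply/Lip_curves_cvgP => r r0.
  have [k /= kr] := filter_ex (near_infty_natSinv_lt (PosNum r0)).
  apply: filterS (S_P k) => n SP t; rewrite /w; case: pselect => Sn; last by rewrite mdistxx.
  have [_ /(_ (\val t) (set_valP t)) ct] := SP Sn.
  exact: lt_trans kr.
have := (GL gamma).1 w w_gamma.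
have w_short : (limn_einf (fun n => L_ (d_ n) (w n)) <= (\val d (x, y) - e / 2)%:E)%E.
  have [N0 _ SB] := S_P 0%N.
  apply: limn_einf_le_frequently => N; have [n Nn Sn] := freqS (maxn N N0).
  move: Nn; rewrite geq_max => /andP[Nn N0n].
  have [Bn _] := SB n N0n Sn.
  exists n => //; rewrite /w; case: pselect => // _'.
  rewrite /L_ /= (curve_length_to_closure alpha_gt1 (d_ n) (fun t => c n (\val t))).
  have [_ _ cd _] := cP n.
  have len := curve_length_le (length_distances_distance (d_ n)) (fun t => c n (\val t))
    (fun t => (\val (d_ n) (x, y) + e / 2) * t).
  apply: le_trans (len _) _ => [s t st|].
    by rewrite -mulrBr; apply: (le_trans (cd _ _)); rewrite distrC ger0_norm // subr_ge0.
  rewrite mulr1 mulr0 subr0 lee_fin.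
  suff : \val (d_ n) (x, y) + e / 2 <= \val d (x, y) - e / 2 by [].
  have /negP : ~ (\val d (x, y) <= \val (d_ n) (x, y) + e) by [].
  by rewrite -ltNge; lra.
move=> /le_trans/(_ w_short) L_gamma.
have := le_trans (endpoints_le_curve_length (rho := closure_dist d) (\val gamma)) L_gamma.
have ends t z : (forall n, c n t = z) -> gamma0 t = \val z.
  move=> cz; apply: mdist_positivity; apply/eqP; rewrite eq_le mdist_ge0 andbT.
  apply/ler_addgt0Pr => r r0; have [n /= /ltW] := filter_ex (near_gamma0 t _ r0).
  by rewrite cz add0r.
have -> : \val gamma (unit_point 1) = to_closure y.
  apply: val_inj; rewrite /= unit_clamp_ge1 //; apply: ends => n; by case: (cP n).
have -> : \val gamma (unit_point 0) = to_closure x.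
  apply: val_inj; rewrite /= unit_clamp_le0 //; apply: ends => n; by case: (cP n).
rewrite (closure_dist_to_closure alpha_gt1) lee_fin.
have [_ _ -> _] := length_distances_distance d; lra.
Qed.

End distances_from_lengths.

(** * The equivalence *)

(* The base point z0 in the second condition only serves to make the product
   a (pointed) measurable space of the library. If Omega is empty, B(Omega) is
   {0}, all four conditions hold, and quantifying over z0 agrees with that. *)
Theorem theorem3p1 (R : realType) (X : metricType R)
    (X_loc_compact : locally_compact [set: X]) (X_complete : complete_space X)
    (alpha : R) (alpha_gt1 : 1 < alpha)
    (Omega : set X) (Omega_open : open Omega)
    (distances_neq0 : length_distances alpha Omega !=set0)
    (d_ : nat -> length_distances alpha Omega) (d : length_distances alpha Omega) :
  [<-> d_ n @[n --> \oo] --> d;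
       forall z0 : Omega * Omega,
         Gamma_cvg (fun n => J_ z0 (d_ n)) (J_ z0 d);
       Gamma_cvg (fun n => L_ (d_ n)) (L_ d);
       Gamma_cvg (fun n => F_ (d_ n)) (F_ d)].
Proof.
have i_pw : d_ n @[n --> \oo] --> d <-> pointwise_cvg d_ d.
  exact: (length_distances_cvgP alpha_gt1).
have ii_pw : (forall z0 : Omega * Omega, Gamma_cvg (fun n => J_ z0 (d_ n)) (J_ z0 d)) <->
    pointwise_cvg d_ d.
  split; first exact: (pointwise_cvg_of_J X_loc_compact alpha_gt1 Omega_open).
  by move=> pw z0; exact: (J_Gamma_cvg X_loc_compact alpha_gt1 Omega_open).
have iii_pw : Gamma_cvg (fun n => L_ (d_ n)) (L_ d) <-> pointwise_cvg d_ d.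
  split; first exact: (pointwise_cvg_of_L X_loc_compact X_complete alpha_gt1).
  exact: (L_Gamma_cvg alpha_gt1).
have iv_pw : Gamma_cvg (fun n => F_ (d_ n)) (F_ d) <-> pointwise_cvg d_ d.
  split; first exact: (pointwise_cvg_of_F X_loc_compact alpha_gt1 Omega_open).
  exact: (F_Gamma_cvg X_loc_compact alpha_gt1 Omega_open).
tfae.
- by move=> /i_pw/ii_pw.
- by move=> /ii_pw/iii_pw.
- by move=> /iii_pw/iv_pw.
- by move=> /iv_pw/i_pw.
Qed.
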